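(* There exist numerical constants $0<c_0,c_1,c_2<\infty$ and, for every $p\in\mathbb{N}$, a positive number $\hat{\ell}_p\le e^{c_1 p\log p+c_1}$ depending only on $p$, such that the following holds. Let $p\in\mathbb{N}$, $p\ge 1$, and let $\Delta$, $L_p$ and $\epsilon$ be positive. Then $$\mathcal{T}_\epsilon\big(\mathcal{A}_{\mathsf{rand}},\mathcal{F}_p(\Delta,L_p)\big)\ \ge\ c_0\cdot\Delta\left(\frac{L_p}{\hat{\ell}_p}\right)^{1/p}\epsilon^{-\frac{1+p}{p}}.$$ Moreover, this lower bound holds even if $\mathcal{F}_p(\Delta,L_p)$ is restricted to functions whose domain $\mathbb{R}^d$ has dimension $$d=\left\lceil\max\left\{1,\ 1+c_2\, q\!\left(\Delta\left(\frac{L_p}{\hat{\ell}_p}\right)^{1/p}\epsilon^{-\frac{1+p}{p}}\right)\right\}\right\rceil,\qquad q(x)=x^2\log(2x).$$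
   Context: $\mathbb{N}=\{1,2,\dots\}$ and $\|\cdot\|$ is the Euclidean norm. Function class. A function $f:\mathbb{R}^d\to\mathbb{R}$ has $L_p$-Lipschitz $p$th order derivatives if it is $p$ times continuously differentiable and for every $x\in\mathbb{R}^d$ and $v\in\mathbb{R}^d$ with $\|v\|\le1$ the function $f_{x,v}(t):=f(x+tv)$, $t\in\mathbb{R}$, satisfies $|f_{x,v}^{(p)}(t)-f_{x,v}^{(p)}(t')|\le L_p|t-t'|$ for all $t,t'\in\mathbb{R}$. $\mathcal{F}_p(\Delta,L_p)$ is the union over $d\in\mathbb{N}$ of the collection of $C^\infty$ functions $f:\mathbb{R}^d\to\mathbb{R}$ with $L_p$-Lipschitz $p$th order derivatives and $f(0)-\inf_x f(x)\le\Delta$. Algorithms. For a function $f$, let $\nabla^{(0,1,\dots)}f(x)$ denote the collection of $f(x)$ and all derivatives $\nabla f(x),\nabla^2 f(x),\dots$ at $x$. A randomized algorithm $\mathsf{A}$ consists, for every dimension $d$, of measurable mappings $\mathsf{A}^{(i)}$ ($i\in\mathbb{N}$) into $\mathbb{R}^d$ (dependence on $d$ implicit); operating on $f:\mathbb{R}^d\to\mathbb{R}$ it draws $\xi\sim\mathrm{Uniform}[0,1]$ independently of $f$ and produces the random sequence of iterates $\mathsf{A}[f]=\{x^{(t)}\}_{t\in\mathbb{N}}\subset\mathbb{R}^d$ given by $$x^{(i)}=\mathsf{A}^{(i)}\big(\xi,\nabla^{(0,1,\dots)}f(x^{(1)}),\dots,\nabla^{(0,1,\dots)}f(x^{(i-1)})\big),\quad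 i\in\mathbb{N}.$$ $\mathcal{A}_{\mathsf{rand}}$ is the class of all such randomized algorithms. Complexity. For a random process $\{x^{(t)}\}_{t\in\mathbb{N}}$ with law $P$, $$\mathsf{T}_\epsilon(P,f):=\inf\Big\{t\in\mathbb{N}\ \Big|\ P\big(\|\nabla f(x^{(s)})\|>\epsilon\text{ for all }s\le t\big)\le\tfrac12\Big\},$$ and $\mathsf{T}_\epsilon(\mathsf{A},f)$ is this quantity for the law of $\mathsf{A}[f]$. For an algorithm class $\mathcal{A}$ and function class $\mathcal{F}$, $\mathcal{T}_\epsilon(\mathcal{A},\mathcal{F}):=\inf_{\mathsf{A}\in\mathcal{A}}\sup_{f\in\mathcal{F}}\mathsf{T}_\epsilon(\mathsf{A},f)$. *)

(* Defs.v *)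
From HB Require Import structures.
From mathcomp Require Import all_boot all_order all_algebra.
From mathcomp Require Import all_classical all_reals all_analysis.
Import Order.TTheory GRing.Theory Num.Theory.
Import numFieldNormedType.Exports.

Set Implicit Arguments.
Unset Strict Implicit.
Unset Printing Implicit Defensive.

Local Open Scope classical_set_scope.
Local Open Scope ring_scope.

(* The built-in norm `|v| of 'rV[R]_d is
   the sup norm, hence a separate Euclidean norm; the topology is the same. *)
Definition enorm (R : realType) (d : nat) (v : 'rV[R]_d) : R :=
  Num.sqrt (\sum_(j < d) v ord0 j ^+ 2).

Section Smoothness.
Context {R : realType} {d : nat}.
Implicit Types (f : 'rV[R]_d -> R) (s : seq 'I_d) (x v : 'rV[R]_d).

(* partial [:: i1; ...; iq] f x is the entry (i1, ..., iq) of the derivative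
   tensor of order q of f at x; in particular partial [::] f = f. *)
Definition partial s f : 'rV[R]_d -> R :=
  foldr (fun i g => 'D_(delta_mx ord0 i) g) f s.

Definition grad f x : 'rV[R]_d := \row_(i < d) partial [:: i] f x.

Definition cont_diff (k : nat) f : Prop :=
  forall s, (size s <= k)%N ->
    continuous (partial s f) /\
    ((size s < k)%N ->
      forall i x, derivable (partial s f) x (delta_mx ord0 i)).

Definition smooth f : Prop := forall k, cont_diff k f.

Definition line f x v : R -> R := fun t => f (x + t *: v).

Definition lipschitz_derivs (p : nat) (L : R) f : Prop :=
  cont_diff p f /\
  forall x v, enorm v <= 1 ->
    forall t t' : R,
      `|derive1n p (line f x v) t - derive1n p (line f x v) t'| <= L * `|t - t'|.

End Smoothness.

(* A class of functions over all dimensions: one set of functions for each d. *)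
Definition fun_class (R : realType) := forall d : nat, set ('rV[R]_d -> R).

(* The infimum is taken in the extended reals, so that functions unbounded
   below are excluded. *)
Definition Fclass (R : realType) (p : nat) (Delta L : R) : fun_class R :=
  fun d => [set f | (0 < d)%N /\ smooth f /\ lipschitz_derivs p L f /\
    ((f 0)%:E - ereal_inf [set (f x)%:E | x in [set: 'rV[R]_d]] <= Delta%:E)%E].

Definition restrict_dim (R : realType) (d0 : nat) (F : fun_class R) :
    fun_class R :=
  fun d => [set f | d = d0 /\ F d f].

Definition borel_rV (R : realType) (d : nat) :=
  g_sigma_algebraType (@open 'rV[R]_d).

(* Values of all derivatives of all orders at one point, all entries of all
   tensors being listed, with the product sigma-algebra. *)
Definition jet_cylinder (R : realType) (d : nat) :
    set (set (seq 'I_d -> R)) :=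
  [set A | exists (s : seq 'I_d) (B : set R),
    measurable B /\ A = [set J | B (J s)]].

Definition jet_space (R : realType) (d : nat) :=
  g_sigma_algebraType (@jet_cylinder R d).

Definition jet (R : realType) (d : nat) (f : 'rV[R]_d -> R) (x : 'rV[R]_d) :
    jet_space R d :=
  fun s => partial s f x.

(* Queries are numbered from 0: query A d i maps the seed and the i previous
   oracle answers to the (i+1)-th iterate. The seed ranges over R but is drawn
   from the uniform distribution on [0, 1]. *)
Record rand_algorithm (R : realType) := RandAlgorithm {
  query : forall d i : nat, R * i.-tuple (jet_space R d) -> 'rV[R]_d ;
  query_measurable : forall d i : nat,
    measurable_fun [set: R * i.-tuple (jet_space R d)]
      (@query d i : _ -> borel_rV R d) }.

Arguments query {R} A d i _ : rename.

Section Execution.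
Context {R : realType} (A : rand_algorithm R) {d : nat} (f : 'rV[R]_d -> R).

Fixpoint history (xi : R) (i : nat) : i.-tuple (jet_space R d) :=
  if i is j.+1 then
    [tuple of rcons (history xi j) (jet f (query A d j (xi, history xi j)))]
  else [tuple].

Definition iterate (i : nat) (xi : R) : 'rV[R]_d :=
  query A d i (xi, history xi i).

End Execution.

(* As X 0, X 1, ... are the iterates x^(1), x^(2), ..., the condition s < t
   below ranges over the first t iterates; the value is +oo when no t works. *)
Definition process_complexity (R : realType) (disp : measure_display)
    (T : measurableType disp) (P : probability T R) (d : nat)
    (X : nat -> T -> 'rV[R]_d) (eps : R) (f : 'rV[R]_d -> R) : \bar R :=
  ereal_inf [set t%:R%:E | t in [set t : nat | (0 < t)%N /\
    (P [set w | forall s, (s < t)%N -> (eps < enorm (grad f (X s w)))%R]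
       <= (2^-1)%:E)%E]].

Definition alg_complexity (R : realType) (A : rand_algorithm R) (d : nat)
    (eps : R) (f : 'rV[R]_d -> R) : \bar R :=
  process_complexity (uniform_prob (@ltr01 R)) (iterate A f) eps f.

Definition class_complexity (R : realType) (eps : R)
    (AA : set (rand_algorithm R)) (F : fun_class R) : \bar R :=
  ereal_inf [set ereal_sup [set T | exists (d : nat) (f : 'rV[R]_d -> R),
                              F d f /\ T = alg_complexity A eps f]
            | A in AA].

Definition A_rand (R : realType) : set (rand_algorithm R) :=
  [set: rand_algorithm R].

Definition qfun (R : realType) (x : R) : R := x ^+ 2 * ln (2 * x).

(* Main.v *)
Require Import Defs.
From HB Require Import structures.
From mathcomp Require Import all_boot all_order all_algebra.
From mathcomp Require Import all_classical all_reals all_analysis.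
From mathcomp Require Import measurable_realfun ring lra zify.
Import Order.TTheory GRing.Theory Num.Theory.
Import numFieldNormedType.Exports.

(** The lower bound comes from a chain of T blocks of coordinates that has to
be unlocked one block after the other, each block hiding a random sign vector.

Write h for the flat function with h(x) = exp(-1/x) for x > 0 and h(x) = 0 for
x <= 0.  In block i let w be a unit vector with entries of equal modulus and
random signs, and let the activation of the block be the concave quadratic
  A_i(x) = <w, x> - |x|^2 / 16       (over the coordinates of block i).
With the convention A_0 = 2, the hard function is, up to rescaling,
  chain(x) = kappa |x|^2 - sum_(i < T) h(A_i(x) - 1) h(A_(i+1)(x) + 1).

Large gradient ([chain_grad_gt]).  If the last block is not activated, i.e.
A_T(x) < 2, look at the first j with A_j(x) < 2.  The term linking j - 1 to j
has a coefficient bounded below, so either A_j still increases at a definite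
rate, or A_j <= -1/2; in the second case x is not small in block j and the
quadratic term produces a gradient.

Smoothness ([deriv_bound_chain]).  Along a line each A_i is a quadratic
polynomial whose derivative is controlled by the part of the direction in
block i wherever A_i > -1, hence wherever h(A_i - 1) or h(A_i + 1) does not
vanish: the negative quadratic part of A_i plays the role of a cutoff.  Since the derivatives of h
are combinations of the bounded functions x^(-n) h(x), each product linking two
blocks has a k-th derivative of size at most 10^k (3k)! times the k-th power of
the length of the direction in these two blocks.  The squared lengths add up to at most a
constant, so the bound does not depend on T or on the dimension.

Hidden information ([jet_hard_trunc], [card_act_ge1], [exists_resisting]).  If
A_i(x) < 1 for all i >= t, then near x only the first t terms of the sum are
present, and all derivatives at x are functions of the signs in blocks 1 to t.
Hence, as long as the queries have this property, the s-th query (counted from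
0) depends only on the signs of blocks 1 to s, and for a block i > s it is
independent of the signs in that block; an exponential moment bound gives
  Pr (A_i(x) >= 1) <= exp(- size of the block / 32)
for each point x, however large.  With blocks of size 128 T + 1 a union bound
over the at most T^2 pairs (s, i) shows that with probability more than 1/2 no
block is guessed and the first T gradients are all large.  This holds for each
fixed seed; averaging over the seed, some choice of signs has the same
property with respect to the seed.

The T blocks need about 128 T^2 coordinates, and rescaling the function and
its argument turns the values T, kappa/4 and the derivative bound into Delta,
eps and L, with T about kappa/4 times
Delta (L/ell)^(1/p) eps^(-(1+p)/p). *)

Set Implicit Arguments.
Unset Strict Implicit.
Unset Printing Implicit Defensive.

Local Open Scope classical_set_scope.
Local Open Scope ring_scope.

(** * Flat exponential functions *)

(** The family is closed under derivation up to linear combinations, which is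
what makes bounds on all derivatives of exp(-1/x) elementary. *)
Definition hexp (R : realType) (n : nat) (x : R) : R :=
  if 0 < x then x^-1 ^+ n * expR (- x^-1) else 0.

Section Hexp.
Context {R : realType}.
Implicit Types (x : R) (n : nat).

Lemma hexp_ge0 n x : 0 <= hexp n x.
Proof.
rewrite /hexp; case: ifP => // x0.
by rewrite mulr_ge0 ?expR_ge0// exprn_ge0// invr_ge0 ltW.
Qed.

Lemma hexp_eq0 n x : x <= 0 -> hexp n x = 0.
Proof. by rewrite /hexp leNgt => /negbTE ->. Qed.

Lemma hexpS n x : 0 < x -> hexp n x = x * hexp n.+1 x.
Proof.
by move=> x0; rewrite /hexp x0 exprS !mulrA divff ?mul1r// gt_eqF.
Qed.

(** In the variable y = 1/x this is y^n / n! <= exp y, a term of the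
exponential series. *)
Lemma hexp_le_fact n x : hexp n x <= n`!%:R.
Proof.
rewrite /hexp; case: ifP => // x0.
set y := x^-1; have y0 : 0 <= y by rewrite invr_ge0 ltW.
rewrite expRN ler_pdivrMr ?expR_gt0//.
case: n => [|n].
  by rewrite expr0 mul1r (le_trans _ (expR_ge1Dx _))// lerDl.
have H := expR_ge1Dxn n y0.
have f0 : 0 < n.+1`!%:R :> R by rewrite ltr0n fact_gt0.
by rewrite mulrC -ler_pdivrMr//; apply: le_trans H; rewrite lerDr.
Qed.

Lemma ler_hexp0 x y : x <= y -> hexp 0 x <= hexp 0 y.
Proof.
move=> xy; have [x0|x0] := ltP 0 x; last by rewrite hexp_eq0// hexp_ge0.
rewrite /hexp x0 (lt_le_trans x0 xy) !expr0 !mul1r ler_expR lerN2 lef_pV2//.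
by rewrite posrE (lt_le_trans x0 xy).
Qed.

(** At 0 the difference quotient of hexp n is hexp n.+1, which is at most
n.+2! |x|: this is the bound for hexp n.+2 again. *)
Lemma is_derive_hexp n x :
  is_derive x 1 (hexp n) (hexp n.+2 x - n%:R * hexp n.+1 x).
Proof.
have [x0|x0|x0] := ltgtP x 0.
- rewrite !hexp_eq0 ?(ltW x0)// mulr0 subr0.
  apply: (@near_eq_is_derive _ _ _ (cst 0)).
  by near=> y; rewrite hexp_eq0//; apply: ltW; near: y; apply: lt_nbhsl.
- apply: (@near_eq_is_derive _ _ _
    ((fun y : R => y^-1) ^+ n * (expR \o (fun y : R => - y^-1)))).
    near=> y; rewrite /hexp /= ifT; first by rewrite fctE exprfctE.
    by near: y; apply: lt_nbhsr.
  have dV : is_derive x 1 (fun y : R => y^-1) (- x ^- 2).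
    apply: DeriveDef; first by apply: derivableV => //; rewrite gt_eqF.
    by rewrite deriveV ?gt_eqF// derive_val /GRing.scale /= mulr1.
  have dE : is_derive x 1 (expR \o (fun y : R => - y^-1))
      (expR (- x^-1) * x ^- 2).
    have := @is_derive1_comp R expR (fun y : R => - y^-1) x (expR (- x^-1)) (x ^- 2).
    apply; apply: is_derive_eq; by rewrite opprK.
  apply: is_derive_eq.
  rewrite /hexp x0 /= exprfctE /GRing.scale /= /=.
  case: n => [|n]; first by rewrite !expr0 !mul0r mulr0; field; rewrite gt_eqF.
  rewrite -!exprVn !exprS; move: (x^-1 ^+ n) (expR _) => a b /=.
  rewrite -natr1; field.
  by rewrite gt_eqF.
- subst x; rewrite !hexp_eq0// mulr0 subr0.
  have key : h^-1 *: ((hexp n \o shift 0) (h *: (1 : R)) - hexp n 0) @[h --> (0 : R)^'] --> (0 : R).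
    have D : (n.+2`!%:R * `|h|) @[h --> (0 : R)^'] --> (0 : R).
      suff : (n.+2`!%:R * `|h|) @[h --> (0 : R)^'] --> n.+2`!%:R * `|0 : R|.
        by rewrite normr0 mulr0.
      apply: cvg_within_filter.
      by apply: cvgM; [exact: cvg_cst|exact: norm_continuous].
    apply/norm_cvg0P; apply: squeeze_cvgr D; last exact: cvg_cst.
    near=> h; rewrite normr_ge0 /= (hexp_eq0 n (lexx 0)) subr0 addr0.
    rewrite /GRing.scale /= mulr1.
    have [h0|h0] := ltP 0 h; last by rewrite hexp_eq0// mulr0 normr0 mulr_ge0.
    rewrite hexpS// mulrA mulVf ?gt_eqF// mul1r hexpS// normrM mulrC.
    by rewrite ler_wpM2r// ger0_norm ?hexp_ge0// hexp_le_fact.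
  apply: DeriveDef; last exact/cvg_lim.
  by apply/cvg_ex; exists 0.
Unshelve. all: by end_near. Qed.

Lemma continuous_hexp n : continuous (@hexp R n).
Proof.
move=> x; apply/differentiable_continuous/derivable1_diffP.
by have [] := is_derive_hexp n x.
Qed.

End Hexp.

(** * Smooth elementary functions *)

Lemma is_derive_affine (R : realType) (a b t : R) :
  is_derive t 1 (fun t => a + b * t) b.
Proof.
have := @is_deriveD _ _ _ (cst a) (b *: id) t 1 _ _ (is_derive_cst _ _ _)
  (@is_deriveZ _ _ _ (@id R) b t 1 1 (is_derive_id _ _)).
by rewrite add0r /GRing.scale /= mulr1.
Qed.

Lemma is_derive_quadratic (R : realType) (a b c t : R) :
  is_derive t 1 (fun t => a + b * t + c * t ^+ 2) (b + 2 * c * t).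
Proof.
have := @is_deriveD _ _ _ (fun t => a + b * t) (c *: (@id R) ^+ 2) t 1 _ _
  (is_derive_affine a b t)
  (@is_deriveZ _ _ _ _ c t 1 _ (@is_deriveX _ _ (@id R) 2 t 1 1 (is_derive_id _ _))).
move=> D; apply: is_derive_eq D _; rewrite /GRing.scale /= expr1; ring.
Qed.

Section Lines.
Context {R : realType} {d : nat}.
Implicit Types (f g : 'rV[R]_d -> R) (x v : 'rV[R]_d).

Lemma is_derive_line f x v (t df : R) :
  is_derive (x + t *: v) v f df <-> is_derive t 1 (line f x v) df.
Proof.
have E : (fun h : R => h^-1 *: ((f \o shift (x + t *: v)) (h *: v) - f (x + t *: v)))
  = (fun h : R => h^-1 *: ((line f x v \o shift t) (h *: (1 : R)) - line f x v t)).
  apply/funext => h; rewrite /line /=; congr (_ *: (f _ - _)).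
  by rewrite [h *: 1]mulr1 scalerDl addrCA.
split=> -[dfx fx]; apply: DeriveDef.
- by rewrite /derivable -E.
- by rewrite /derive -E.
- by rewrite /derivable E.
- by rewrite /derive E.
Qed.

Lemma is_derive_line0 f x v (df : R) :
  is_derive x v f df <-> is_derive (0 : R) (1 : R) (line f x v) df.
Proof. by rewrite -is_derive_line scale0r addr0. Qed.

(** A class of functions that contains the hard functions and is stable under
directional derivatives, so that membership gives smoothness of all orders. *)
Inductive elementary : ('rV[R]_d -> R) -> Prop :=
| Elem_cst c : elementary (fun=> c)
| Elem_coord k : elementary (fun x => x ord0 k)
| Elem_add f g : elementary f -> elementary g -> elementary (fun x => f x + g x)
| Elem_mul f g : elementary f -> elementary g -> elementary (fun x => f x * g x)
| Elem_hexp n f : elementary f -> elementary (fun x => hexp n (f x)).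

Lemma elementary_continuous f : elementary f -> continuous f.
Proof.
elim=> {f} [c|k|f g _ cf _ cg|f g _ cf _ cg|n f _ cf] x.
- exact: cst_continuous.
- exact: coord_continuous.
- exact: (@continuousD _ _ _ f g x (cf x) (cg x)).
- exact: (@continuousM _ _ f g x (cf x) (cg x)).
- exact: (continuous_comp (cf x) (@continuous_hexp _ n _)).
Qed.

Lemma is_derive_coord k x v : is_derive x v (fun y : 'rV[R]_d => y ord0 k) (v ord0 k).
Proof.
apply/is_derive_line0.
have -> : line (fun y => y ord0 k) x v = (fun t => x ord0 k + v ord0 k * t).
  by apply/funext => t; rewrite /line !mxE mulrC.
exact: is_derive_affine.
Qed.

Lemma is_derive_hexp_comp n f x v df : is_derive x v f df ->
  is_derive x v (fun y => hexp n (f y))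
    ((hexp n.+2 (f x) - n%:R * hexp n.+1 (f x)) * df).
Proof.
move=> /is_derive_line0 dfx; apply/is_derive_line0.
apply: (@is_derive1_comp R (hexp n) (line f x v)) => //.
by rewrite /line scale0r addr0; exact: is_derive_hexp.
Qed.

Lemma elementary_derive f v : elementary f ->
  exists2 g, elementary g & forall x, is_derive x v f (g x).
Proof.
elim=> {f} [c|k|f g Ef [f' Ef' df] Eg [g' Eg' dg]|
    f g Ef [f' Ef' df] Eg [g' Eg' dg]|n f Ef [f' Ef' df]].
- by exists (fun=> 0); [exact: Elem_cst|move=> x; exact: is_derive_cst].
- by exists (fun=> v ord0 k); [exact: Elem_cst|move=> x; exact: is_derive_coord].
- exists (fun x => f' x + g' x); first exact: Elem_add.
  by move=> x; exact: (@is_deriveD _ _ _ f g).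
- exists (fun x => f x * g' x + g x * f' x).
    by apply: Elem_add; exact: Elem_mul.
  by move=> x; exact: (@is_deriveM _ _ f g).
- exists (fun x => (hexp n.+2 (f x) + - n%:R * hexp n.+1 (f x)) * f' x).
    apply: Elem_mul => //; apply: Elem_add; first exact: Elem_hexp.
    by apply: Elem_mul; [exact: Elem_cst|exact: Elem_hexp].
  by move=> x; rewrite mulNr; exact: is_derive_hexp_comp.
Qed.

Lemma elementary_partial f s : elementary f -> elementary (partial s f).
Proof.
move=> Ef; elim: s => //= i s /(elementary_derive (delta_mx ord0 i))[g Eg dg].
suff -> : 'D_(delta_mx ord0 i) (partial s f) = g by [].
by apply/funext => x; exact: derive_val.
Qed.

Lemma elementary_smooth f : elementary f -> smooth f.
Proof.
move=> Ef k s _; split; first exact/elementary_continuous/elementary_partial.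
move=> _ i x.
by have [g _ /(_ x)[]] := elementary_derive (delta_mx ord0 i) (elementary_partial s Ef).
Qed.

Lemma elementary_sum I (r : seq I) (P : pred I) (F : I -> 'rV[R]_d -> R) :
  (forall i, elementary (F i)) ->
  elementary (fun x => \sum_(i <- r | P i) F i x).
Proof.
move=> EF; elim: r => [|i r IH].
  by under eq_fun do rewrite big_nil; exact: Elem_cst.
under eq_fun do rewrite big_cons; case: (P i) => //.
exact: Elem_add.
Qed.

Lemma elementary_scale f (s : R) : elementary f -> elementary (fun x => f (s *: x)).
Proof.
elim=> {f} [c|k|f g _ Ef _ Eg|f g _ Ef _ Eg|n f _ Ef].
- exact: Elem_cst.
- under eq_fun do rewrite mxE.
  by apply: Elem_mul; [exact: Elem_cst|exact: Elem_coord].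
- exact: Elem_add.
- exact: Elem_mul.
- exact: Elem_hexp.
Qed.

(** All derivatives at a point are determined by the germ of the function:
this is how the oracle answers hide the blocks that are not yet reached. *)
Lemma eq_partial_near s f g x :
  (\forall y \near x, f y = g y) -> partial s f x = partial s g x.
Proof.
move=> fg; apply: (@nbhs_singleton _ x (fun y => partial s f y = partial s g y)).
elim: s => [//|i s IH] /=.
have := nbhs_interior IH; apply: filterS => y /=.
by move=> yI; apply: near_eq_derive.
Qed.

End Lines.

(** * Bounds on derivatives of one real variable *)

Section DerivBounds.
Context {R : realType}.
Implicit Types (f g : R -> R) (M N s t : R) (k : nat).

(** Stated without an operator for iterated derivatives, so that a bound is
proved by exhibiting the successive derivatives. *)
Fixpoint deriv_bound k f M : Prop :=
  if k is k'.+1 then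
    exists2 f', (forall t, is_derive t 1 f (f' t)) & deriv_bound k' f' M
  else forall t, `|f t| <= M.

Lemma deriv_bound_derive1n k f M : deriv_bound k.+1 f M ->
  exists2 g, (forall t, is_derive t 1 (derive1n k f) (g t)) & (forall t, `|g t| <= M).
Proof.
elim: k f => [|k IH] f [f' df]; first by move=> bf'; exists f'.
move=> /IH[g dg bg]; exists g => // t; rewrite derive1Sn.
suff -> : derive1 f = f' by exact: dg.
by apply/funext => u; rewrite derive1E; exact: derive_val.
Qed.

Lemma deriv_bound_lipschitz k f M : deriv_bound k.+1 f M ->
  forall t t', `|derive1n k f t - derive1n k f t'| <= M * `|t - t'|.
Proof.
move=> /deriv_bound_derive1n[g dg bg].
have cf : continuous (derive1n k f).
  by move=> t; apply/differentiable_continuous/derivable1_diffP; have [] := dg t.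
have main t t' : t <= t' -> `|derive1n k f t' - derive1n k f t| <= M * `|t' - t|.
  move=> tt'; have [c _ ->] := @MVT_segment _ _ _ t t' tt' (fun u _ => dg u)
    (continuous_subspaceT cf).
  by rewrite normrM ler_wpM2r.
move=> t t'; have [/main|/ltW/main//] := leP t t'.
by rewrite distrC [in leRHS]distrC.
Qed.

Lemma deriv_bound_le k f M N : M <= N -> deriv_bound k f M -> deriv_bound k f N.
Proof.
move=> MN; elim: k f => [|k IH] f /=; first by move=> H t; exact: le_trans MN.
by move=> [f' df /IH]; exists f'.
Qed.

Lemma deriv_boundD k f g M N : deriv_bound k f M -> deriv_bound k g N ->
  deriv_bound k (fun t => f t + g t) (M + N).
Proof.
elim: k f g => [|k IH] f g /=.
  by move=> bf bg t; exact: le_trans (ler_normD _ _) (lerD (bf t) (bg t)).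
move=> [f' df bf] [g' dg bg]; exists (fun t => f' t + g' t); last exact: IH.
by move=> t; exact: (@is_deriveD _ _ _ f g).
Qed.

Lemma deriv_boundZ k f M c : deriv_bound k f M ->
  deriv_bound k (fun t => c * f t) (`|c| * M).
Proof.
elim: k f => [|k IH] f /=; first by move=> bf t; rewrite normrM ler_wpM2l.
move=> [f' df bf]; exists (fun t => c * f' t); last exact: IH.
by move=> t; exact: (@is_deriveZ _ _ _ f c).
Qed.

Lemma deriv_bound_sum k (I : Type) (r : seq I) (F : I -> R -> R) (m : I -> R) :
  (forall i, deriv_bound k (F i) (m i)) ->
  deriv_bound k (fun t => \sum_(i <- r) F i t) (\sum_(i <- r) m i).
Proof.
move=> bF; elim: r => [|i r IH].
  under eq_fun do rewrite big_nil; rewrite big_nil.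
  elim: k {bF} => [|k IH] /=; first by move=> t; rewrite normr0.
  by exists (fun=> 0) => // t; exact: is_derive_cst.
under eq_fun do rewrite big_cons; rewrite big_cons.
exact: deriv_boundD.
Qed.

Lemma is_derive_comp_scale f (s t df : R) : is_derive (s * t) 1 f df ->
  is_derive t 1 (fun u => f (s * u)) (s * df).
Proof.
move=> dfst; rewrite mulrC.
apply: (@is_derive1_comp R f (fun u => s * u)).
have := @is_deriveZ _ _ _ (@id R) s t 1 1 (is_derive_id _ _).
by rewrite /GRing.scale /= mulr1.
Qed.

Lemma deriv_bound_comp_scale k f M s : deriv_bound k f M ->
  deriv_bound k (fun t => f (s * t)) (`|s| ^+ k * M).
Proof.
elim: k f => [|k IH] f /=; first by move=> bf t; rewrite expr0 mul1r.
move=> [f' df bf]; exists (fun t => s * f' (s * t)).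
  by move=> t; apply: is_derive_comp_scale.
by rewrite exprS -mulrA; apply/deriv_boundZ/IH.
Qed.

Lemma deriv_bound_quadratic k (a b c : R) :
  deriv_bound k.+2 (fun t => a + b * t + c * t ^+ 2) (2 * `|c|).
Proof.
exists (fun t => b + 2 * c * t); first exact: is_derive_quadratic.
exists (fun=> 2 * c); first by move=> t; exact: is_derive_affine.
have c2 : `|2 * c| = 2 * `|c| by rewrite normrM ger0_norm.
case: k => [|k]; first by move=> t; rewrite c2.
exists (fun=> 0); first by move=> t; exact: is_derive_cst.
elim: k => [|k IH] /=; first by move=> t; rewrite normr0 mulr_ge0.
by exists (fun=> 0) => // t; exact: is_derive_cst.
Qed.

(** The form taken by the derivatives of hexp 0 composed with a quadratic
polynomial A of derivative A': since A' has a constant derivative, these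
functions are closed under derivation. *)
Definition hexp_pow (n j : nat) (A A' : R -> R) (t : R) : R :=
  hexp n (A t) * A' t ^+ j.

Lemma is_derive_hexp_pow n j (A A' : R -> R) (c t : R) :
  is_derive t 1 A (A' t) -> is_derive t 1 A' c ->
  is_derive t 1 (hexp_pow n j A A')
    (hexp_pow n.+2 j.+1 A A' t - n%:R * hexp_pow n.+1 j.+1 A A' t
     + j%:R * c * hexp_pow n j.-1 A A' t).
Proof.
move=> dA dA'.
have dH : is_derive t 1 (hexp n \o A)
    ((hexp n.+2 (A t) - n%:R * hexp n.+1 (A t)) * A' t).
  by apply: is_derive1_comp; exact: is_derive_hexp.
have := @is_deriveM _ _ (hexp n \o A) (A' ^+ j) t 1 _ _ dH (is_deriveX j dA').
have -> : (hexp n \o A) * A' ^+ j = hexp_pow n j A A'.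
  by apply/funext => u; rewrite /hexp_pow !fctE.
move=> dP; apply: is_derive_eq dP _.
rewrite /hexp_pow exprfctE /GRing.scale /= !exprS; ring.
Qed.

Lemma leq_mul_fact n m : (n`! * m`! <= (n + m)`!)%N.
Proof.
have := @bin_fact (n + m) n (leq_addr _ _); rewrite addKn => <-.
by rewrite leq_pmull// bin_gt0 leq_addr.
Qed.

Section Family.
Variables (A A' B B' : R -> R) (a b Om : R).
Hypothesis dA : forall t, is_derive t 1 A (A' t).
Hypothesis dA' : forall t, is_derive t 1 A' a.
Hypothesis dB : forall t, is_derive t 1 B (B' t).
Hypothesis dB' : forall t, is_derive t 1 B' b.
Hypothesis Om0 : 0 <= Om.
Hypothesis bA : forall t, 0 < A t -> `|A' t| <= 2 * Om.
Hypothesis bB : forall t, 0 < B t -> `|B' t| <= 2 * Om.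
Hypothesis ba : `|a| <= 2 * Om ^+ 2.
Hypothesis bb : `|b| <= 2 * Om ^+ 2.

Let P n j := hexp_pow n j A A'.
Let Q n j := hexp_pow n j B B'.

Let Bd (J N k : nat) : R := Om ^+ (J + k) * 2 ^+ J * 10 ^+ k * (N + 3 * k)`!%:R.

Let norm_hexp_pow n j (C C' : R -> R) t : (forall t, 0 < C t -> `|C' t| <= 2 * Om) ->
  `|hexp_pow n j C C' t| <= n`!%:R * (2 * Om) ^+ j.
Proof.
move=> bC; rewrite /hexp_pow; have [C0|C0] := ltP 0 (C t); last first.
  by rewrite hexp_eq0// mul0r normr0 mulr_ge0// exprn_ge0// mulr_ge0.
rewrite normrM normrX ler_pM ?exprn_ge0//.
  by rewrite ger0_norm ?hexp_ge0// hexp_le_fact.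
by rewrite lerXn2r ?nnegrE ?mulr_ge0// bC.
Qed.

(* The three terms of the derivative of a hexp_pow factor: in the third one a
   derivative of A' is taken, which costs c instead of a factor A'. *)
Let bound_step (c : R) (n j J N k : nat) : `|c| <= 2 * Om ^+ 2 ->
  (n + j <= N)%N -> (j <= J)%N ->
  Bd J.+1 N.+3 k + (n%:R * Bd J.+1 N.+2 k + j%:R * `|c| * Bd J.-1 N.-1 k) <=
  5 * (Om ^+ (J + k.+1) * 2 ^+ J * 10 ^+ k * (N + 3 * k.+1)`!%:R).
Proof.
move=> bc njN jJ; rewrite /Bd.
set F := (N + 3 * k.+1)`!%:R : R.
have E1 : (N.+3 + 3 * k)`!%:R = F by congr (_`!%:R); lia.
have E2 : n%:R * (N.+2 + 3 * k)`!%:R <= F.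
  rewrite -natrM ler_nat; have -> : (N + 3 * k.+1 = (N.+2 + 3 * k).+1)%N by lia.
  by rewrite factS leq_mul//; lia.
have E3 : j%:R * (N.-1 + 3 * k)`!%:R <= F.
  rewrite -natrM ler_nat; have -> : (N + 3 * k.+1 = (N.+2 + 3 * k).+1)%N by lia.
  rewrite factS leq_mul//; first by lia.
  by apply: leq_fact; lia.
rewrite E1.
have -> : (J.+1 + k = J + k.+1)%N by lia.
set W := Om ^+ (J + k.+1) * 2 ^+ J * 10 ^+ k.
have W0 : 0 <= W by rewrite !mulr_ge0// exprn_ge0.
have T1 : Om ^+ (J + k.+1) * 2 ^+ J.+1 * 10 ^+ k * F = 2 * (W * F).
  by rewrite /W exprS; ring.
have T2 : n%:R * (Om ^+ (J + k.+1) * 2 ^+ J.+1 * 10 ^+ k * (N.+2 + 3 * k)`!%:R) <= 2 * (W * F).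
  have -> : n%:R * (Om ^+ (J + k.+1) * 2 ^+ J.+1 * 10 ^+ k * (N.+2 + 3 * k)`!%:R)
      = 2 * (W * (n%:R * (N.+2 + 3 * k)`!%:R)).
    by rewrite /W exprS; ring.
  by rewrite ler_wpM2l// ler_wpM2l.
have T3 : j%:R * `|c| * (Om ^+ (J.-1 + k) * 2 ^+ J.-1 * 10 ^+ k * (N.-1 + 3 * k)`!%:R) <= W * F.
  case: j jJ njN E3 => [|j] jJ njN E3; first by rewrite !mul0r mulr_ge0.
  have -> : j.+1%:R * `|c| * (Om ^+ (J.-1 + k) * 2 ^+ J.-1 * 10 ^+ k * (N.-1 + 3 * k)`!%:R)
     = `|c| * (Om ^+ (J.-1 + k) * 2 ^+ J.-1 * 10 ^+ k) * (j.+1%:R * (N.-1 + 3 * k)`!%:R) by ring.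
  apply: ler_pM => //.
    by rewrite mulr_ge0// !mulr_ge0// exprn_ge0.
  have -> : W = 2 * Om ^+ 2 * (Om ^+ (J.-1 + k) * 2 ^+ J.-1 * 10 ^+ k).
    rewrite /W; case: J jJ {W W0 T1 T2} => // J _ /=.
    by rewrite (_ : (J.+1 + k.+1 = (J + k).+2)%N) ?exprS ?expr0; [ring|lia].
  by rewrite ler_wpM2r// !mulr_ge0// exprn_ge0.
rewrite T1; lra.
Qed.

(** The factor A' is bounded only where A > 0, which is enough because
hexp n A vanishes elsewhere.  Carrying the powers of A' and B' as indices makes
every derivative a combination of functions for which this pointwise
argument applies; the factorial absorbs the coefficients n and j. *)
Lemma deriv_bound_hexp_pow k n j m l :
  deriv_bound k (fun t => P n j t * Q m l t) (Bd (j + l) (n + m + j + l) k).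
Proof.
elim: k n j m l => [|k IH] n j m l /=.
  move=> t; rewrite normrM (le_trans (ler_pM _ _ (norm_hexp_pow _ _ _ bA)
    (norm_hexp_pow _ _ _ bB)))// mulrACA -exprD exprMn /Bd addn0 muln0 addn0.
  rewrite expr0 mulr1 mulrC [_ ^+ _ * Om ^+ _]mulrC ler_wpM2l//.
    by rewrite mulr_ge0// exprn_ge0.
  rewrite -natrM ler_nat (leq_trans (leq_mul_fact _ _))// leq_fact//; lia.
pose DP t := P n.+2 j.+1 t - n%:R * P n.+1 j.+1 t + j%:R * a * P n j.-1 t.
pose DQ t := Q m.+2 l.+1 t - m%:R * Q m.+1 l.+1 t + l%:R * b * Q m l.-1 t.
exists (fun t => P n j t * DQ t + Q m l t * DP t).
  move=> t; apply: (@is_deriveM _ _ (P n j) (Q m l)).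
    exact: is_derive_hexp_pow.
  exact: is_derive_hexp_pow.
have E : (fun t => P n j t * DQ t + Q m l t * DP t) =
  (fun t => (P n.+2 j.+1 t * Q m l t + (- n%:R * (P n.+1 j.+1 t * Q m l t)
              + j%:R * a * (P n j.-1 t * Q m l t)))
          + (P n j t * Q m.+2 l.+1 t + (- m%:R * (P n j t * Q m.+1 l.+1 t)
              + l%:R * b * (P n j t * Q m l.-1 t)))).
  by apply/funext => t; rewrite /DP /DQ; ring.
rewrite E.
have bP : deriv_bound k (fun t => P n.+2 j.+1 t * Q m l t +
    (- n%:R * (P n.+1 j.+1 t * Q m l t) + j%:R * a * (P n j.-1 t * Q m l t)))
   (5 * (Om ^+ (j + l + k.+1) * 2 ^+ (j + l) * 10 ^+ k *
      (n + m + j + l + 3 * k.+1)`!%:R)).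
  apply: deriv_bound_le (@bound_step a n j (j + l) (n + m + j + l) k ba _ _) _; try lia.
  apply: deriv_boundD; last apply: deriv_boundD.
  - by have := IH n.+2 j.+1 m l; congr (deriv_bound _ _ (Bd _ _ _)); lia.
  - have := deriv_boundZ (- n%:R) (IH n.+1 j.+1 m l); rewrite normrN normr_nat.
    by congr (deriv_bound _ _ (_ * Bd _ _ _)); lia.
  - have := deriv_boundZ (j%:R * a) (IH n j.-1 m l); rewrite normrM normr_nat.
    case: (j) => [|j'] /=; first by rewrite !mul0r.
    by congr (deriv_bound _ _ (_ * Bd _ _ _)); lia.
have bQ : deriv_bound k (fun t => P n j t * Q m.+2 l.+1 t +
    (- m%:R * (P n j t * Q m.+1 l.+1 t) + l%:R * b * (P n j t * Q m l.-1 t)))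
   (5 * (Om ^+ (j + l + k.+1) * 2 ^+ (j + l) * 10 ^+ k *
      (n + m + j + l + 3 * k.+1)`!%:R)).
  apply: deriv_bound_le (@bound_step b m l (j + l) (n + m + j + l) k bb _ _) _; try lia.
  apply: deriv_boundD; last apply: deriv_boundD.
  - by have := IH n j m.+2 l.+1; congr (deriv_bound _ _ (Bd _ _ _)); lia.
  - have := deriv_boundZ (- m%:R) (IH n j m.+1 l.+1); rewrite normrN normr_nat.
    by congr (deriv_bound _ _ (_ * Bd _ _ _)); lia.
  - have := deriv_boundZ (l%:R * b) (IH n j m l.-1); rewrite normrM normr_nat.
    case: (l) => [|l'] /=; first by rewrite !mul0r.
    by congr (deriv_bound _ _ (_ * Bd _ _ _)); lia.
apply: deriv_bound_le (deriv_boundD bP bQ).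
by rewrite /Bd [in leRHS]exprS; lra.
Qed.

Lemma deriv_bound_hexp2 k :
  deriv_bound k (fun t => hexp 0 (A t) * hexp 0 (B t))
    (Om ^+ k * (10 ^+ k * (3 * k)`!%:R)).
Proof.
have := deriv_bound_hexp_pow k 0 0 0 0.
rewrite /Bd /P /Q /hexp_pow add0n expr0 mulr1 -mulrA.
by under eq_fun do rewrite !expr0 !mulr1.
Qed.

End Family.
End DerivBounds.

(** * The chain function *)

Section Chain.
Context {R : realType} {d : nat}.
Variable blk : 'I_d -> nat.
Implicit Types (w : 'I_d -> R) (x v : 'rV[R]_d) (i j T : nat).

(** Block 0 is the constant threshold 2, so that the first block is
unlocked from the start.  The quadratic term makes the activation concave and
its gradient at x of norm sqrt(1 - A/4), see [act_sqnorm]. *)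
Definition act w i x : R :=
  if i is 0 then 2 else \sum_(k | blk k == i) (w k * x ord0 k - 16^-1 * x ord0 k ^+ 2).

Definition dact w i x v : R :=
  if i is 0 then 0 else \sum_(k | blk k == i) (w k - 8^-1 * x ord0 k) * v ord0 k.

Definition blk_sqnorm i v : R :=
  if i is 0 then 0 else \sum_(k | blk k == i) v ord0 k ^+ 2.

(** A sixteenth of the lower bound exp(-1) exp(-2) / 9 on the coefficient of
the first locked block; the quadratic term must not cancel its gradient. *)
Definition kappa : R := expR (- 3) / 144.

Definition chain w T x : R :=
  kappa * (\sum_k x ord0 k ^+ 2) -
  \sum_(i < T) hexp 0 (act w i x - 1) * hexp 0 (act w i.+1 x + 1).

Lemma kappa_gt0 : 0 < kappa.
Proof. by rewrite divr_gt0// expR_gt0. Qed.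

Lemma kappa_le1 : kappa <= 1.
Proof.
have : expR (- 3) <= 1 :> R by rewrite expR_le1 oppr_le0.
by rewrite /kappa ler_pdivrMr//; lra.
Qed.

Lemma act_line w i x v t :
  act w i (x + t *: v) = act w i x + dact w i x v * t + - 16^-1 * blk_sqnorm i v * t ^+ 2.
Proof.
case: i => [|i] /=; first by ring.
rewrite mulrAC mulr_suml mulr_sumr -!big_split /=; apply: eq_bigr => k _.
by rewrite !mxE; field.
Qed.

Lemma dact_line w i x v t :
  dact w i (x + t *: v) v = dact w i x v + 2 * (- 16^-1 * blk_sqnorm i v) * t.
Proof.
case: i => [|i] /=; first by ring.
rewrite -mulrA mulrAC -mulrA !mulr_sumr -big_split /=; apply: eq_bigr => k _.
by rewrite !mxE; field.
Qed.

Lemma act_elementary w i : elementary (act w i).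
Proof.
case: i => [|i]; first exact: Elem_cst.
apply: elementary_sum => k.
have -> : (fun x : 'rV[R]_d => w k * x ord0 k - 16^-1 * x ord0 k ^+ 2) =
  (fun x => w k * x ord0 k + - 16^-1 * (x ord0 k * x ord0 k)).
  by apply/funext => x; rewrite mulNr expr2.
by apply: Elem_add; (apply: Elem_mul; first exact: Elem_cst);
   [exact: Elem_coord|apply: Elem_mul; exact: Elem_coord].
Qed.

Lemma chain_elementary w T : elementary (chain w T).
Proof.
have -> : chain w T = (fun x => kappa * (\sum_k x ord0 k * x ord0 k) + -1 *
    \sum_(i < T) hexp 0 (act w i x + - 1) * hexp 0 (act w i.+1 x + 1)).
  by apply/funext => x; rewrite mulN1r.
apply: Elem_add; (apply: Elem_mul; first exact: Elem_cst).
  by apply: elementary_sum => k; apply: Elem_mul; exact: Elem_coord.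
apply: elementary_sum => i; apply: Elem_mul; apply: Elem_hexp;
  (apply: Elem_add; [exact: act_elementary|exact: Elem_cst]).
Qed.

Lemma chain_ge w T x : - T%:R <= chain w T x.
Proof.
rewrite /chain -[leLHS]add0r lerD//.
  by rewrite mulr_ge0 ?(ltW kappa_gt0)//; apply: sumr_ge0 => k _; exact: sqr_ge0.
rewrite lerN2 (@le_trans _ _ (\sum_(i < T) 1))//.
  apply: ler_sum => i _; rewrite -[leRHS]mulr1.
  by rewrite ler_pM ?hexp_ge0//; exact: (le_trans (hexp_le_fact _ _)).
by rewrite sumr_const card_ord.
Qed.

Lemma chain0_le0 w T : chain w T 0 <= 0.
Proof.
rewrite /chain big1 ?mulr0 ?sub0r; last by move=> k _; rewrite mxE expr0n.
by rewrite oppr_le0 sumr_ge0// => i _; rewrite mulr_ge0// hexp_ge0.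
Qed.

Lemma act_trunc w w' i x : (forall k, (blk k <= i)%N -> w k = w' k) ->
  act w i x = act w' i x.
Proof.
by case: i => //= i ww'; apply: eq_bigr => k /eqP bk; rewrite ww'// bk.
Qed.

Lemma chain_trunc w w' T : (forall k, (blk k <= T)%N -> w k = w' k) ->
  chain w T = chain w' T.
Proof.
move=> ww'; apply/funext => x; rewrite /chain; congr (_ - _).
apply: eq_bigr => i _; congr (hexp 0 (_ - _) * hexp 0 (_ + _)).
  by apply: act_trunc => k ki; apply: ww'; rewrite (leq_trans ki)// ltnW.
by apply: act_trunc => k ki; apply: ww'; rewrite (leq_trans ki).
Qed.

(** The factor h(A_i - 1) of the i-th term vanishes near each point where
A_i < 1. *)
Lemma chain_near w s T x : (s <= T)%N ->
  (forall i, (s <= i < T)%N -> act w i x < 1) ->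
  \forall y \near x, chain w T y = chain w s y.
Proof.
move=> sT; rewrite -(subnK sT) addnC; elim: (T - s)%N => [|n IH] H.
  by rewrite addn0; near=> y.
have {}IH := IH (fun i Hi => H i ltac:(lia)).
have cA : \forall y \near x, act w (s + n) y < 1.
  have cont : continuous (act w (s + n)) := elementary_continuous (act_elementary w (s + n)).
  have A1 : act w (s + n) x < 1 by apply: H; lia.
  exact: (cont x _ (lt_nbhsl A1)).
near=> y.
rewrite -(near IH y)// /chain addnS big_ord_recr /= (hexp_eq0 0 (x := act _ _ _ - 1)).
  by rewrite mul0r addr0.
by rewrite subr_le0 ltW//; near: y.
Unshelve. all: by end_near. Qed.

End Chain.

Section ChainGradient.
Context {R : realType} {d : nat}.
Variables (blk : 'I_d -> nat) (w : 'I_d -> R) (T : nat).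
Hypothesis blk_gt0 : forall k, (0 < blk k)%N.
Hypothesis w1 : forall i, (0 < i <= T)%N -> \sum_(k | blk k == i) w k ^+ 2 = 1.
Implicit Types (x v : 'rV[R]_d) (i j : nat).

Local Notation act := (act blk w).
Local Notation dact := (dact blk w).
Local Notation chain := (chain blk w).
Local Notation sqn := (@blk_sqnorm R d blk).
Local Notation kappa := (@kappa R).

Lemma is_derive_act i x v : is_derive x v (act i) (dact i x v).
Proof.
apply/is_derive_line0; rewrite /line.
under eq_fun do rewrite act_line.
by apply: is_derive_eq (is_derive_quadratic _ _ _ _) _; rewrite mulr0 addr0.
Qed.

Definition dchain x v : R := kappa * (2 * \sum_k x ord0 k * v ord0 k) -
  \sum_(i < T) (hexp 2 (act i x - 1) * dact i x v * hexp 0 (act i.+1 x + 1)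
              + hexp 0 (act i x - 1) * (hexp 2 (act i.+1 x + 1) * dact i.+1 x v)).

Lemma is_derive_chain x v : is_derive x v (chain T) (dchain x v).
Proof.
have dsq k : is_derive x v (fun y : 'rV[R]_d => y ord0 k ^+ 2) (2 * (x ord0 k * v ord0 k)).
  have := @is_deriveX _ _ _ 2 x v _ (is_derive_coord k x v).
  by rewrite /GRing.scale /= expr1 mulrA.
have dn : is_derive x v (fun y : 'rV[R]_d => \sum_k y ord0 k ^+ 2)
    (2 * \sum_k x ord0 k * v ord0 k).
  rewrite mulr_sumr.
  have := @is_derive_sum _ _ _ _ _ x v _ dsq.
  by congr (is_derive _ _ _ _); apply/funext => y; rewrite fct_sumE.
have dh c i : is_derive x v (fun y => hexp 0 (act i y + c)) (hexp 2 (act i x + c) * dact i x v).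
  have dA : is_derive x v (fun y => act i y + c) (dact i x v).
    have := @is_deriveD _ _ _ (act i) (cst c) x v _ _ (is_derive_act i x v) (is_derive_cst _ _ _).
    by rewrite addr0.
  by have := is_derive_hexp_comp 0 dA; rewrite mul0r subr0.
have dt i : is_derive x v (fun y => hexp 0 (act i y - 1) * hexp 0 (act i.+1 y + 1))
   (hexp 2 (act i x - 1) * dact i x v * hexp 0 (act i.+1 x + 1)
              + hexp 0 (act i x - 1) * (hexp 2 (act i.+1 x + 1) * dact i.+1 x v)).
  have := @is_deriveM _ _ (fun y => hexp 0 (act i y - 1)) (fun y => hexp 0 (act i.+1 y + 1))
     x v _ _ (dh (-1) i) (dh 1 i.+1).
  by move=> D; apply: is_derive_eq D _; rewrite /GRing.scale /= addrC mulrC.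
have ds : is_derive x v (fun y => \sum_(i < T) hexp 0 (act i y - 1) * hexp 0 (act i.+1 y + 1))
  (\sum_(i < T) (hexp 2 (act i x - 1) * dact i x v * hexp 0 (act i.+1 x + 1)
              + hexp 0 (act i x - 1) * (hexp 2 (act i.+1 x + 1) * dact i.+1 x v))).
  have := @is_derive_sum _ _ _ T (fun (i : 'I_T) y =>
    hexp 0 (act i y - 1) * hexp 0 (act i.+1 y + 1)) x v _ (fun i : 'I_T => dt i).
  by congr (is_derive _ _ _ _); apply/funext => y; rewrite fct_sumE.
exact: (@is_deriveB _ _ _ (fun y => kappa * _) _ x v _ _ (@is_deriveZ _ _ _ _ kappa x v _ dn) ds).
Qed.

(** Minus the partial derivative of the chain with respect to the activation
A_j. *)
Definition chain_coef j x : R :=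
  \sum_(i < T) ((j == i)%:R * (hexp 2 (act i x - 1) * hexp 0 (act i.+1 x + 1))
              + (j == i.+1)%:R * (hexp 0 (act i x - 1) * hexp 2 (act i.+1 x + 1))).

Lemma dact_delta i k x :
  dact i x (delta_mx ord0 k) = (blk k == i)%:R * (w k - 8^-1 * x ord0 k).
Proof.
case: i => [|i]; first by rewrite eqn0Ngt blk_gt0 mul0r.
rewrite /=; have [bk|bk] := eqVneq (blk k) i.+1.
  rewrite mul1r (bigD1 k) ?bk//= big1 ?addr0; first by rewrite mxE !eqxx mulr1.
  by move=> l /andP[_ lk]; rewrite mxE (negbTE lk) mulr0.
rewrite mul0r big1// => l /eqP bl; rewrite mxE eqxx /=; case: eqP => [lk|]; last by rewrite mulr0.
by rewrite -lk bl eqxx in bk.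
Qed.

Lemma grad_chain x k : grad (chain T) x ord0 k =
  2 * kappa * x ord0 k - (w k - 8^-1 * x ord0 k) * chain_coef (blk k) x.
Proof.
rewrite mxE /partial /=.
rewrite (@derive_val _ _ _ _ _ _ _ (is_derive_chain x (delta_mx ord0 k))) /dchain; congr (_ - _).
  rewrite (bigD1 k)//= big1 ?addr0; first by rewrite mxE !eqxx mulr1; ring.
  by move=> l lk; rewrite mxE (negbTE lk) mulr0.
rewrite mulr_sumr; apply: eq_bigr => i _; rewrite !dact_delta; ring.
Qed.

Lemma chain_coef_ge0 j x : 0 <= chain_coef j x.
Proof.
by apply: sumr_ge0 => i _; rewrite addr_ge0// !mulr_ge0// ?hexp_ge0.
Qed.

Lemma chain_coef_ge j x : (j < T)%N ->
  hexp 0 (act j x - 1) * hexp 2 (act j.+1 x + 1) <= chain_coef j.+1 x.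
Proof.
move=> jT; rewrite /chain_coef (bigD1 (Ordinal jT))//=.
rewrite eqxx (gtn_eqF (ltnSn j)) mul0r add0r mul1r lerDl.
by apply: sumr_ge0 => i _; rewrite addr_ge0// !mulr_ge0// ?hexp_ge0.
Qed.

(** Bounding a norm below through its product with a test vector v: expand the
square of g - s v.  The choice of s avoids dividing by the norm of v. *)
Lemma sumr_sqr_ge (I : finType) (P : pred I) (s : R) (g v : I -> R) :
  2 * s * (\sum_(k | P k) g k * v k) - s ^+ 2 * (\sum_(k | P k) v k ^+ 2)
   <= \sum_(k | P k) g k ^+ 2.
Proof.
rewrite !mulr_sumr -sumrB; apply: ler_sum => k _.
by rewrite -subr_ge0 (_ : _ - _ = (g k - s * v k) ^+ 2) ?sqr_ge0//; ring.
Qed.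

Lemma CauchySchwarz_sum (I : finType) (P : pred I) (g v : I -> R) :
  (\sum_(k | P k) g k * v k) ^+ 2 <=
  (\sum_(k | P k) g k ^+ 2) * (\sum_(k | P k) v k ^+ 2).
Proof.
set p := \sum_(k | P k) _; set V := \sum_(k | P k) v k ^+ 2; set G := \sum_(k | P k) _.
have V0 : 0 <= V by apply: sumr_ge0 => k _; exact: sqr_ge0.
have [V00|Vn0] := eqVneq V 0.
  have -> : p = 0.
    rewrite /p big1// => k Pk.
    have /eqP := V00; rewrite psumr_eq0; last by move=> l _; exact: sqr_ge0.
    by move=> /allP/(_ k (mem_index_enum _)); rewrite Pk /= sqrf_eq0 => /eqP ->; rewrite mulr0.
  by rewrite expr0n /= V00 mulr0.
have Vp : 0 < V by rewrite lt_def Vn0.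
have := sumr_sqr_ge P (p / V) g v; rewrite -/p -/V -/G.
rewrite -(ler_pM2r Vp); apply: le_trans.
by rewrite le_eqVlt; apply/orP; left; apply/eqP; field.
Qed.

Lemma act_sqnorm i x : (0 < i <= T)%N ->
  \sum_(k | blk k == i) (w k - 8^-1 * x ord0 k) ^+ 2 = 1 - 4^-1 * act i x.
Proof.
case: i => // i iT; rewrite -[X in _ = X - _](w1 iT) /= mulr_sumr -sumrB; apply: eq_bigr => k _.
by field.
Qed.

(** Cauchy-Schwarz with [act_sqnorm]: the slope of the activation is bounded
even where x is large, as long as the activation is not below -1. *)
Lemma dact_bound i x v : (i <= T)%N -> -1 <= act i x ->
  dact i x v ^+ 2 <= 2 * sqn i v.
Proof.
case: i => [|i] iT A1; first by rewrite expr0n mulr0.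
rewrite (le_trans (CauchySchwarz_sum _ _ _))// (@act_sqnorm i.+1)//.
rewrite ler_wpM2r//; first by apply: sumr_ge0 => k _; exact: sqr_ge0.
by lra.
Qed.

(** A_i <= -1/2 forces x away from the origin in block i, because
<w, x>^2 <= |x|^2 there. *)
Lemma act_sqnorm_ge i x : (0 < i <= T)%N -> act i x <= - 2^-1 ->
  16^-1 <= \sum_(k | blk k == i) x ord0 k ^+ 2.
Proof.
case: i => // i iT; rewrite /= sumrB -mulr_sumr.
have := sumr_sqr_ge (fun k => blk k == i.+1) (\sum_(k | blk k == i.+1) w k * x ord0 k)
  (fun k => x ord0 k) w.
rewrite (w1 iT) [X in 2 * _ * X](eq_bigr (fun k => w k * x ord0 k)); last first.
  by move=> k _; rewrite mulrC.
set y := \sum_(k | _) w k * _; set n := \sum_(k | _) _ => yn An.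
rewrite leNgt; apply/negP => n16.
have y4 : y < - 4^-1 by lra.
nra.
Qed.

Lemma enorm_sqr n (v : 'rV[R]_n) : enorm v ^+ 2 = \sum_k v ord0 k ^+ 2.
Proof. by rewrite sqr_sqrtr// sumr_ge0// => k _; exact: sqr_ge0. Qed.

Lemma hexp2_ge (z : R) : 2^-1 <= z <= 3 -> expR (- 2) / 9 <= hexp 2 z.
Proof.
move=> /andP[z1 z2]; have z0 : 0 < z by lra.
have zV : 3^-1 <= z^-1 by rewrite lef_pV2 ?posrE.
have zV2 : z^-1 <= 2 by rewrite -[leRHS]invrK lef_pV2 ?posrE ?invr_gt0.
rewrite /hexp z0 [leLHS]mulrC; apply: ler_pM; rewrite ?expR_ge0 ?invr_ge0//.
  by rewrite expr2; nra.
by rewrite ler_expR lerN2.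
Qed.

(** In the first block j with A_j < 2 the gradient is 2 kappa x - G v, where v
is the gradient of A_j and G = chain_coef j x >= 0.  If A_j <= -1/2 then
<x, v> <= 0 and testing against x leaves the quadratic term alone.  Otherwise
G >= 16 kappa, since block j - 1 is activated, while <x, v> < 2 and |v|^2 >= 1/2;
testing against - v gives at least 8 kappa |v|^2. *)
Lemma chain_grad_gt x : (0 < T)%N -> act T x < 2 ->
  kappa / 4 < enorm (grad (chain T) x).
Proof.
move=> T0 AT2.
have [j /andP[j0 Aj2] jmin] : exists2 j, (0 < j)%N && (act j x < 2) &
    forall i, (0 < i)%N && (act i x < 2) -> (j <= i)%N.
  have ex : exists j, (0 < j)%N && (act j x < 2) by exists T; rewrite T0.
  by exists (ex_minn ex); case: ex_minnP.
have jT : (0 < j <= T)%N by rewrite j0 jmin// T0.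
have kp := @kappa_gt0 R.
suff H : (kappa / 4) ^+ 2 < enorm (grad (chain T) x) ^+ 2.
  by move: H; rewrite ltr_pXn2r ?nnegrE ?sqrtr_ge0// divr_ge0// ltW.
rewrite enorm_sqr.
set g := fun k => grad (chain T) x ord0 k.
apply: (@lt_le_trans _ _ (\sum_(k | blk k == j) g k ^+ 2)); last first.
  rewrite [leRHS](bigID (fun k => blk k == j))/= lerDl.
  by apply: sumr_ge0 => k _; exact: sqr_ge0.
set G := chain_coef j x.
have G0 : 0 <= G := chain_coef_ge0 j x.
have gE k : blk k == j -> g k = 2 * kappa * x ord0 k - (w k - 8^-1 * x ord0 k) * G.
  by move=> /eqP bk; rewrite /g grad_chain bk.
set n := \sum_(k | blk k == j) x ord0 k ^+ 2.
have n0 : 0 <= n by apply: sumr_ge0 => k _; exact: sqr_ge0.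
have xv : \sum_(k | blk k == j) x ord0 k * (w k - 8^-1 * x ord0 k) = act j x - 16^-1 * n.
  rewrite /n; case: (j) j0 => // i _ /=; rewrite mulr_sumr -sumrB; apply: eq_bigr => k _.
  by field.
have [Aj|Aj] := leP (act j x) (- 2^-1).
  have n16 := act_sqnorm_ge jT Aj; rewrite -/n in n16.
  apply: lt_le_trans (sumr_sqr_ge _ (2 * kappa) g (fun k => x ord0 k)).
  have -> : \sum_(k | blk k == j) g k * x ord0 k = 2 * kappa * n - (act j x - 16^-1 * n) * G.
    rewrite -xv mulr_sumr mulr_suml -sumrB; apply: eq_bigr => k bk; rewrite gE//; ring.
  have : 0 <= - (act j x - 16^-1 * n) * G by rewrite mulr_ge0//; lra.
  rewrite -/n; move: kp; move: kappa => K; nra.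
have V : \sum_(k | blk k == j) (w k - 8^-1 * x ord0 k) ^+ 2 = 1 - 4^-1 * act j x.
  exact: act_sqnorm.
have GK : 16 * kappa <= G.
  have {}jT : (j.-1 < T)%N by lia.
  have := chain_coef_ge x jT; rewrite prednK// -/G; apply: le_trans.
  have -> : 16 * kappa = expR (-1) * (expR (- 2) / 9).
    rewrite mulrA -expRD /kappa.
    have -> : -1 + -2 = -3 :> R by ring.
    by field.
  apply: ler_pM; rewrite ?divr_ge0 ?expR_ge0//; last by apply: hexp2_ge; lra.
  have -> : expR (-1) = hexp 0 1 :> R by rewrite /hexp ltr01 invr1 expr0 mul1r.
  apply: ler_hexp0; rewrite lerBrDr.
  case: (posnP j.-1) => [->|j1]; first by rewrite /=; lra.
  rewrite -[leLHS]/2 leNgt; apply/negP => A2.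
  by have := jmin j.-1; rewrite j1 A2 => /(_ isT); lia.
apply: lt_le_trans (sumr_sqr_ge _ (- 8 * kappa) g (fun k => w k - 8^-1 * x ord0 k)).
have -> : \sum_(k | blk k == j) g k * (w k - 8^-1 * x ord0 k) =
    2 * kappa * (act j x - 16^-1 * n) - (1 - 4^-1 * act j x) * G.
  rewrite -xv -V mulr_sumr mulr_suml -sumrB; apply: eq_bigr => k bk; rewrite gE//; ring.
rewrite V.
have : (1 - 4^-1 * act j x) * (16 * kappa) <= (1 - 4^-1 * act j x) * G.
  by rewrite ler_wpM2l//; lra.
have : 0 <= kappa * n by rewrite mulr_ge0// ltW.
move: kp Aj2 Aj; move: kappa (act j x) G n {n0 xv V gE GK G0} => K A G n kp A2 A1 Kn GV.
have K2 : 0 < K * K by rewrite mulr_gt0.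
have KA : 0 < K * (2 - A) by rewrite mulr_gt0// subr_gt0.
nra.
Qed.

End ChainGradient.

(** * Dimension-free smoothness of the chain *)

Section ChainDerivBound.
Context {R : realType} {d : nat}.
Variables (blk : 'I_d -> nat) (w : 'I_d -> R) (T : nat).
Hypothesis blk_gt0 : forall k, (0 < blk k)%N.
Hypothesis w1 : forall i, (0 < i <= T)%N -> \sum_(k | blk k == i) w k ^+ 2 = 1.
Implicit Types (x v : 'rV[R]_d) (i j : nat).

Local Notation sqn := (@blk_sqnorm R d blk).

Lemma blk_sqnormE i v : sqn i v = \sum_(k | blk k == i) v ord0 k ^+ 2.
Proof.
case: i => //; rewrite big_pred0// => k; by rewrite eqn0Ngt blk_gt0.
Qed.

Lemma blk_sqnorm_ge0 i v : 0 <= sqn i v.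
Proof. by rewrite blk_sqnormE; apply: sumr_ge0 => k _; exact: sqr_ge0. Qed.

Lemma blk_sqnorm_le i v : sqn i v <= \sum_k v ord0 k ^+ 2.
Proof.
rewrite blk_sqnormE [leRHS](bigID (fun k => blk k == i))/= lerDl.
by apply: sumr_ge0 => k _; exact: sqr_ge0.
Qed.

Lemma sum_blk_sqnorm_le c v : \sum_(i < T) sqn (i + c)%N v <= \sum_k v ord0 k ^+ 2.
Proof.
under eq_bigr do rewrite blk_sqnormE.
rewrite (exchange_big_dep predT)//=; apply: ler_sum => k _.
rewrite sumr_const -[leRHS]mulr1n ler_wpMn2l ?sqr_ge0//.
apply/card_le1P => i + j; rewrite !inE => /eqP ki; rewrite ki.
by rewrite -[LHS]/(i + c == j + c)%N eqn_add2r eq_sym.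
Qed.

Definition chain_bound (k : nat) : R := 10 ^+ k * (3 * k)`!%:R + 2.

(** Each term of the sum is bounded by a constant times Om^(k+2), where
Om^2 = (|v_i|^2 + |v_(i+1)|^2) / 2 <= 1 and v_i is the part of v in block i.
As k+2 >= 2, this is at most Om^2, and the sum over i of Om^2 is
at most 1. *)
Lemma deriv_bound_chain k x v : enorm v <= 1 ->
  deriv_bound k.+2 (line (chain blk w T) x v) (chain_bound k.+2).
Proof.
move=> v1; have {}v1 : \sum_k v ord0 k ^+ 2 <= 1.
  rewrite -enorm_sqr -[leRHS](expr1n _ 2); apply: lerXn2r; rewrite ?nnegrE//.
  exact: sqrtr_ge0.
have bq : deriv_bound k.+2 (fun t => kappa * (\sum_k x ord0 k ^+ 2)
    + kappa * (2 * \sum_k x ord0 k * v ord0 k) * t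
    + kappa * (\sum_k v ord0 k ^+ 2) * t ^+ 2) 2.
  apply: deriv_bound_le (deriv_bound_quadratic _ _ _ _).
  rewrite -[leRHS]mulr1 ler_wpM2l// ger0_norm; last first.
    by rewrite mulr_ge0 ?(ltW (kappa_gt0))// sumr_ge0// => l _; exact: sqr_ge0.
  rewrite mulr_ile1 ?kappa_le1 ?(ltW (kappa_gt0))//.
  by apply: sumr_ge0 => l _; exact: sqr_ge0.
pose Om2 i := 2^-1 * (sqn i v + sqn i.+1 v).
have Om20 i : 0 <= Om2 i by rewrite mulr_ge0// addr_ge0 ?blk_sqnorm_ge0.
have Om21 i : Om2 i <= 1.
  have := blk_sqnorm_le i v; have := blk_sqnorm_le i.+1 v; rewrite /Om2; lra.
pose C : R := 10 ^+ k.+2 * (3 * k.+2)`!%:R.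
have C0 : 0 <= C by rewrite mulr_ge0// exprn_ge0.
have bt (i : 'I_T) : deriv_bound k.+2 (fun t => hexp 0 (act blk w i (x + t *: v) - 1) *
    hexp 0 (act blk w i.+1 (x + t *: v) + 1)) (Om2 i * C).
  have ii : (i <= T)%N by rewrite ltnW.
  pose lineA j c t := (act blk w j x + c) + dact blk w j x v * t + - 16^-1 * sqn j v * t ^+ 2.
  pose lineA' j t := dact blk w j x v + 2 * (- 16^-1 * sqn j v) * t.
  have lineAE j c t : act blk w j (x + t *: v) + c = lineA j c t.
    by rewrite act_line /lineA; ring.
  under eq_fun do rewrite !lineAE.
  have bnd j c t : (j <= T)%N -> c <= 1 -> sqn j v <= 2 * Om2 i -> 0 < lineA j c t ->
      `|lineA' j t| <= 2 * Num.sqrt (Om2 i).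
    move=> jT c1 jO; rewrite -lineAE => A0.
    rewrite /lineA' -dact_line -sqrtr_sqr -[2 * _]ger0_norm ?mulr_ge0 ?sqrtr_ge0//.
    rewrite -[in leRHS]sqrtr_sqr ler_wsqrtr// exprMn sqr_sqrtr//.
    have A1 : -1 <= act blk w j (x + t *: v) by lra.
    apply: le_trans (dact_bound w1 v jT A1) _; lra.
  have ba j : sqn j v <= 2 * Om2 i -> `|2 * (- 16^-1 * sqn j v)| <= 2 * Num.sqrt (Om2 i) ^+ 2.
    have := blk_sqnorm_ge0 j v => s0 sO; rewrite sqr_sqrtr//.
    by rewrite ler_norml; lra.
  have s1 := blk_sqnorm_ge0 i v; have s2 := blk_sqnorm_ge0 i.+1 v.
  have := @deriv_bound_hexp2 R (lineA i (-1)) (lineA' i) (lineA i.+1 1) (lineA' i.+1)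
    (2 * (- 16^-1 * sqn i v)) (2 * (- 16^-1 * sqn i.+1 v)) (Num.sqrt (Om2 i))
    (is_derive_quadratic _ _ _) (is_derive_affine _ _) (is_derive_quadratic _ _ _)
    (is_derive_affine _ _) (sqrtr_ge0 _).
  move=> /(_ _ _ (ba _ _) (ba _ _) k.+2) H.
  apply: deriv_bound_le (H _ _ _ _).
  - rewrite ler_wpM2r// -[k.+2]addn2 exprD sqr_sqrtr// ler_piMl// exprn_ile1// ?sqrtr_ge0//.
    by rewrite -[leRHS]sqrtr1 ler_wsqrtr.
  - by move=> t; apply: bnd => //; rewrite /Om2; lra.
  - by move=> t; apply: bnd => //; rewrite /Om2; lra.
  - by rewrite /Om2; lra.
  - by rewrite /Om2; lra.
have bs := deriv_boundZ (-1) (deriv_bound_sum (index_enum 'I_T) bt).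
have -> : line (chain blk w T) x v = (fun t => (kappa * (\sum_k x ord0 k ^+ 2)
    + kappa * (2 * \sum_k x ord0 k * v ord0 k) * t
    + kappa * (\sum_k v ord0 k ^+ 2) * t ^+ 2) +
    -1 * \sum_(i < T) hexp 0 (act blk w i (x + t *: v) - 1) *
    hexp 0 (act blk w i.+1 (x + t *: v) + 1)).
  apply/funext => t; rewrite /line /chain mulN1r; congr (_ - _).
  have -> : \sum_k (x + t *: v) ord0 k ^+ 2 = \sum_k x ord0 k ^+ 2 +
      (2 * t) * (\sum_k x ord0 k * v ord0 k) + t ^+ 2 * \sum_k v ord0 k ^+ 2.
    rewrite !mulr_sumr -!big_split /=; apply: eq_bigr => l _.
    by rewrite !mxE; ring.
  ring.
apply: deriv_bound_le (deriv_boundD bq bs).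
rewrite normrN1 mul1r /chain_bound -/C addrC lerD2r -mulr_suml ler_piMl//.
rewrite -mulr_sumr big_split /=.
have S1 : \sum_(i < T) sqn i.+1 v <= \sum_k v ord0 k ^+ 2.
  by rewrite (eq_bigr (fun i : 'I_T => sqn (i + 1)%N v)) ?sum_blk_sqnorm_le// => i _; rewrite addn1.
have S0 : \sum_(i < T) sqn i v <= \sum_k v ord0 k ^+ 2.
  by rewrite (eq_bigr (fun i : 'I_T => sqn (i + 0)%N v)) ?sum_blk_sqnorm_le// => i _; rewrite addn0.
lra.
Qed.

End ChainDerivBound.

(** * Guessing the signs of a block *)

Section Tail.
Context {R : realType} {d : nat}.
Variable blk : 'I_d -> nat.
Implicit Types (sg r : {ffun 'I_d -> bool}) (i : nat).

(** For small u use exp u <= 1 / (1 - u) for u and - u; for u^2 >= 1/2 each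
exponential is at most half of the right-hand side. *)
Lemma coshR_le (u : R) : expR u + expR (- u) <= 2 * expR (2 * u ^+ 2).
Proof.
have [u2|u2] := ltP (u ^+ 2) 2^-1; last first.
  have le v : v ^+ 2 = u ^+ 2 -> expR v <= expR (2 * u ^+ 2).
    by move=> vu; rewrite ler_expR -vu; rewrite -vu in u2; nra.
  by have := le u erefl; have := le (- u) (sqrrN u); lra.
have ub : -1 < u < 1 by apply/andP; split; nra.
have e1 : expR u <= (1 - u)^-1.
  rewrite -[u]opprK expRN opprK lef_pV2 ?posrE ?expR_gt0//; last by lra.
  exact: expR_ge1Dx.
have e2 : expR (- u) <= (1 + u)^-1.
  rewrite expRN lef_pV2 ?posrE ?expR_gt0//; last by lra.
  exact: expR_ge1Dx.
have e3 := expR_ge1Dx (2 * u ^+ 2).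
have v0 : 0 < 1 - u ^+ 2 by lra.
have e4 : (1 - u)^-1 + (1 + u)^-1 = 2 / (1 - u ^+ 2) by field; lra.
have e5 : 2 / (1 - u ^+ 2) <= 2 * (1 + 2 * u ^+ 2) by rewrite ler_pdivrMr//; nra.
lra.
Qed.

Definition blk_size i : nat := #|[pred k | blk k == i]|.

Definition weight sg (k : 'I_d) : R := (-1) ^+ sg k / Num.sqrt (blk_size (blk k))%:R.

Lemma sum_weight_sqr sg i : (0 < blk_size i)%N ->
  \sum_(k | blk k == i) weight sg k ^+ 2 = 1.
Proof.
move=> N0; transitivity (\sum_(k | blk k == i) (blk_size i)%:R^-1 : R).
  apply: eq_bigr => k /eqP bk; rewrite /weight bk exprMn exprVn sqr_sqrtr//.
  by rewrite sqrr_sign mul1r.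
by rewrite sumr_const -[LHS]mulr_natl divff// pnatr_eq0 -lt0n.
Qed.

(** Adding signs in one block only: averaging over r resamples the signs of
block i and keeps the other ones. *)
Definition flip i r sg : {ffun 'I_d -> bool} :=
  [ffun k => if blk k == i then sg k (+) r k else sg k].

Lemma flipK i r : involutive (flip i r).
Proof. by move=> sg; apply/ffunP => k; rewrite !ffunE; case: eqP => // _; rewrite addbK. Qed.

(** The exponential moment of the activation of block i under random signs r.
The product over the coordinates has factors
exp(u - 2 u^2) + exp(- u - 2 u^2) <= 2: the negative quadratic term of the
activation compensates the growth of the exponential moment, for every z. *)
Lemma sum_flip_le i sg (z : 'rV[R]_d) : (0 < i)%N ->
  \sum_r expR ((blk_size i)%:R / 32 * (act blk (weight (flip i r sg)) i z - 1))
  <= expR (- ((blk_size i)%:R / 32)) * 2 ^+ d.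
Proof.
move=> i0; set N := blk_size i; set M : R := N%:R / 32.
pose G k b : R := if blk k == i then
   expR (M * ((-1) ^+ (sg k (+) b) / Num.sqrt N%:R * z ord0 k - 16^-1 * z ord0 k ^+ 2)) else 1.
have E r : expR (M * (act blk (weight (flip i r sg)) i z - 1)) = expR (- M) * \prod_k G k (r k).
  rewrite mulrBr mulr1 expRD mulrC; congr (_ * _).
  rewrite [RHS](bigID (fun k => blk k == i))/= [X in _ = _ * X]big1 ?mulr1; last first.
    by move=> k /negbTE bk; rewrite /G bk.
  have -> : act blk (weight (flip i r sg)) i z =
      \sum_(k | blk k == i) (weight (flip i r sg) k * z ord0 k - 16^-1 * z ord0 k ^+ 2).
    by rewrite -(prednK i0).
  rewrite mulr_sumr expR_sum; apply: eq_bigr => k bk.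
  by rewrite /G bk /weight (eqP bk) ffunE bk.
under eq_bigr do rewrite E.
rewrite -mulr_sumr ler_wpM2l ?expR_ge0// -(bigA_distr_bigA G)/=.
rewrite -[X in _ <= _ ^+ X]card_ord -prodr_const; apply: ler_prod => k _.
rewrite big_bool /= addr_ge0/= /G; [|by case: ifP; rewrite ?expR_ge0..].
have [bk|] := eqVneq (blk k) i; last by [].
set c := _ / _.
have N0 : (0 < N)%N by apply/card_gt0P; exists k; rewrite inE bk.
have sN : Num.sqrt (N%:R : R) != 0 by rewrite gt_eqF// sqrtr_gt0 ltr0n.
pose u : R := M * ((-1) ^+ sg k / Num.sqrt N%:R * z ord0 k).
have u2 : 2 * u ^+ 2 = M * (16^-1 * z ord0 k ^+ 2).
  rewrite /u !exprMn !exprVn sqrr_sign sqr_sqrtr// mul1r /M.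
  by field; rewrite pnatr_eq0 -lt0n.
have e1 : M * ((-1) ^+ (sg k (+) false) / Num.sqrt N%:R * z ord0 k - 16^-1 * z ord0 k ^+ 2)
   = u - 2 * u ^+ 2 by rewrite u2 addbF /u; ring.
have e2 : M * (c * z ord0 k - 16^-1 * z ord0 k ^+ 2) = - u - 2 * u ^+ 2.
  by rewrite u2 /c signr_addb /= expr1 /u; ring.
rewrite e1 e2 !expRD -mulrDl [expR (- (2 * _))]expRN ler_pdivrMr ?expR_gt0//.
have := coshR_le u; lra.
Qed.

(** Markov's inequality for the exponential moment, after replacing the sum
over sg by its average over the flips of block i, under which the point Z does
not move. *)
Lemma card_act_ge1 i (Z : {ffun 'I_d -> bool} -> 'rV[R]_d) : (0 < i)%N ->
  (forall sg r, Z (flip i r sg) = Z sg) ->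
  #|[pred sg | 1 <= act blk (weight sg) i (Z sg)]|%:R
  <= expR (- ((blk_size i)%:R / 32)) * 2 ^+ d :> R.
Proof.
move=> i0 Zflip; set M : R := (blk_size i)%:R / 32.
pose F sg := expR (M * (act blk (weight sg) i (Z sg) - 1)).
have M0 : 0 <= M by rewrite divr_ge0.
have cardF : #|{ffun 'I_d -> bool}|%:R = 2 ^+ d :> R.
  by rewrite card_ffun card_bool card_ord natrX.
apply: (@le_trans _ _ (\sum_sg F sg)).
  rewrite -sum1_card natr_sum.
  rewrite [leRHS](bigID (fun sg => sg \in [pred sg | 1 <= act blk (weight sg) i (Z sg)]))/=.
  rewrite -[leLHS]addr0 lerD//; last by apply: sumr_ge0 => sg _; exact: expR_ge0.
  apply: ler_sum => sg; rewrite inE => A1.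
  by rewrite (le_trans _ (expR_ge1Dx _))// lerDl mulr_ge0// subr_ge0.
have p2 : 0 < 2 ^+ d :> R by rewrite exprn_gt0.
rewrite -(ler_pM2l p2).
apply: (@le_trans _ _ (\sum_sg \sum_r F (flip i r sg))).
  rewrite exchange_big /= -cardF mulr_natl -sumr_const le_eqVlt; apply/orP; left; apply/eqP.
  by apply: eq_bigr => r _; rewrite (reindex_inj (inv_inj (flipK i r))).
rewrite -[X in _ <= X * _]cardF mulr_natl -sumr_const; apply: ler_sum => sg _.
rewrite /F; under eq_bigr do rewrite Zflip.
exact: sum_flip_le.
Qed.

End Tail.

(** * Measurability of the iterates *)

Section Measurability.
Context {R : realType}.

Lemma continuous_measurable_borel d (f : 'rV[R]_d -> R) : continuous f ->
  measurable_fun [set: borel_rV R d] (f : borel_rV R d -> R).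
Proof.
move=> /continuousP cf.
apply: (measurability _ (RGenOpens.measurableE R)).
move=> _ [_ [a [b ->] <-]]; rewrite setTI.
by apply: sub_sigma_algebra; apply: cf; exact: interval_open.
Qed.

Lemma measurable_jet d (f : 'rV[R]_d -> R) : smooth f ->
  measurable_fun [set: borel_rV R d] (jet f : borel_rV R d -> jet_space R d).
Proof.
move=> sf; apply: (@measurability _ _ (borel_rV R d) (jet_space R d) setT (jet f)
  (@jet_cylinder R d) (erefl _)).
move=> _ [_ [s [B [mB ->]]] <-]; rewrite setTI.
have [cf _] := sf (size s) s (leqnn _).
by have := continuous_measurable_borel cf measurableT mB; rewrite setTI.
Qed.

Lemma measurable_rcons disp1 disp2 (T1 : measurableType disp1)
    (T2 : measurableType disp2) n (f : T1 -> T2) (g : T1 -> n.-tuple T2) :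
  measurable_fun [set: T1] f -> measurable_fun [set: T1] g ->
  measurable_fun [set: T1] (fun x => [tuple of rcons (g x) (f x)]).
Proof.
move=> mf /measurable_fun_tnthP mg; apply/measurable_fun_tnthP => i.
have [il|il] := ltnP i n.
  rewrite (_ : _ \o _ = (@tnth n T2 ^~ (Ordinal il)) \o g)//.
  apply/funext => x /=; rewrite !(tnth_nth (f x)) /= nth_rcons size_tuple il.
  by [].
rewrite (_ : _ \o _ = f)//; apply/funext => x /=.
have -> : i = ord_max by apply/val_inj => /=; apply/eqP; rewrite eqn_leq il -ltnS ltn_ord.
by rewrite (tnth_nth (f x)) /= nth_rcons size_tuple ltnn eqxx.
Qed.

Context (A : rand_algorithm R) (d : nat) (f : 'rV[R]_d -> R).
Hypothesis sf : smooth f.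

Lemma measurable_history i :
  measurable_fun [set: R] (fun xi : R => history A f xi i).
Proof.
elim: i => [|i IH] /=; first by apply/measurable_fun_tnthP => -[].
apply: measurable_rcons => //.
apply: (measurableT_comp (measurable_jet sf)).
apply: (measurableT_comp (@query_measurable R A d i)).
by apply: measurable_fun_pair.
Qed.

Lemma measurable_iterate i :
  measurable_fun [set: R] (iterate A f i : R -> borel_rV R d).
Proof.
apply: (measurableT_comp (@query_measurable R A d i)).
by apply: measurable_fun_pair => //; exact: measurable_history.
Qed.

Lemma continuous_enorm_grad : continuous (fun x => enorm (grad f x)).
Proof.
have -> : (fun x => enorm (grad f x)) =
    Num.sqrt \o (fun y => \sum_k partial [:: k] f y ^+ 2).
  apply/funext => x; rewrite /enorm /=; congr Num.sqrt.
  by apply: eq_bigr => k _; rewrite mxE.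
have cs : continuous (fun y => \sum_k partial [:: k] f y ^+ 2).
  apply: continuous_big => [|k _ x]; first exact: add_continuous.
  have [ck _] := sf (leqnn (size [:: k])).
  exact: (@continuousM _ _ (partial [:: k] f) (partial [:: k] f) x (ck x) (ck x)).
by move=> x; apply: (continuous_comp (cs x)); exact: sqrt_continuous.
Qed.

Lemma measurable_large_grad eps t : measurable
  [set xi : R | forall s, (s < t)%N -> (eps < enorm (grad f (iterate A f s xi)))%R].
Proof.
have -> : [set xi : R | forall s, (s < t)%N -> (eps < enorm (grad f (iterate A f s xi)))%R]
  = \bigcap_(s in `I_t) [set xi | eps < enorm (grad f (iterate A f s xi))].
  by [].
apply: bigcap_measurableType => s st.
have -> : [set xi | eps < enorm (grad f (iterate A f s xi))] =
   iterate A f s @^-1` [set x | eps < enorm (grad f x)] by [].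
rewrite -[X in measurable X]setTI; apply: measurable_iterate => //.
apply: sub_sigma_algebra.
have := continuous_enorm_grad => /continuousP/(_ _ (@open_gt R eps)).
by [].
Qed.

End Measurability.

(** * Hard instances and simulated runs *)

Section Scaling.
Context {R : realType} {d : nat}.
Implicit Types (g : 'rV[R]_d -> R) (x v : 'rV[R]_d).

Definition rescale (C s : R) g x : R := C * g (s *: x).

Lemma rescale_elementary C s g : elementary g -> elementary (rescale C s g).
Proof.
by move=> Eg; apply: Elem_mul; [exact: Elem_cst|exact: elementary_scale].
Qed.

Lemma line_rescale C s g x v t :
  line (rescale C s g) x v t = C * line g (s *: x) v (s * t).
Proof. by rewrite /line /rescale scalerDr scalerA. Qed.

Lemma enormZ (c : R) v : enorm (c *: v) = `|c| * enorm v.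
Proof.
rewrite /enorm -sqrtr_sqr -sqrtrM ?sqr_ge0//; congr Num.sqrt.
by rewrite mulr_sumr; apply: eq_bigr => k _; rewrite mxE exprMn.
Qed.

Lemma grad_rescale C s g x : elementary g ->
  grad (rescale C s g) x = (C * s) *: grad g (s *: x).
Proof.
move=> Eg; apply/rowP => k; rewrite !mxE /=.
have [g' _ dg] := elementary_derive (delta_mx ord0 k) Eg.
rewrite (@derive_val _ _ _ _ _ _ _ (dg (s *: x))) -mulrA.
have D : is_derive (0 : R) (1 : R) (line (rescale C s g) x (delta_mx ord0 k))
    (C * (s * g' (s *: x))).
  rewrite (_ : line _ _ _ = fun t => C * line g (s *: x) (delta_mx ord0 k) (s * t)); last first.
    by apply/funext => t; rewrite line_rescale.
  apply: (@is_deriveZ _ _ _ (fun t => line g (s *: x) (delta_mx ord0 k) (s * t)) C).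
  by apply: is_derive_comp_scale; rewrite mulr0 -is_derive_line0.
by move: D; rewrite -is_derive_line0 => D; exact: (@derive_val _ _ _ _ _ _ _ D).
Qed.

Lemma rescale_near C s g h x :
  (\forall y \near s *: x, g y = h y) ->
  \forall y \near x, rescale C s g y = rescale C s h y.
Proof.
move=> gh; have cs : continuous (fun y : 'rV[R]_d => s *: y) := @scaler_continuous _ _ s.
apply: (@filterS _ (nbhs x) _ (fun y => g (s *: y) = h (s *: y)) _ _ (cs x _ gh)).
by move=> y e; rewrite /rescale e.
Qed.

End Scaling.

Section HardInstance.
Context {R : realType} {d : nat}.
Variables (blk : 'I_d -> nat) (T : nat) (C s : R).
Hypothesis blk_gt0 : forall k, (0 < blk k)%N.
Hypothesis blk_full : forall i, (0 < i <= T)%N -> (0 < blk_size blk i)%N.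
Hypotheses (C0 : 0 < C) (s0 : 0 < s).
Implicit Types (sg : {ffun 'I_d -> bool}).

(** The number t of terms kept in the chain is a parameter: t = T is the hard
function, and t < T is what the oracle shows before block t is unlocked. *)
Definition hard sg (t : nat) : 'rV[R]_d -> R :=
  rescale C s (chain blk (weight blk sg) t).

Lemma hard_elementary sg t : elementary (hard sg t).
Proof. exact/rescale_elementary/chain_elementary. Qed.

Lemma hard_Fclass sg p Delta L : (0 < d)%N -> (0 < p)%N ->
  C * T%:R <= Delta -> C * (s ^+ p.+1 * chain_bound p.+1) <= L ->
  Fclass p Delta L (hard sg T).
Proof.
move=> d0 p0 CD CL; have Sm := elementary_smooth (hard_elementary sg T).
split=> //; split=> //; split; [split|].
- exact: Sm.
- move=> x v v1.
  rewrite (_ : line _ _ _ =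
    fun t => C * line (chain blk (weight blk sg) T) (s *: x) v (s * t)); last first.
    by apply/funext => t; rewrite line_rescale.
  apply: deriv_bound_lipschitz.
  have w1 i : (0 < i <= T)%N -> \sum_(k | blk k == i) weight blk sg k ^+ 2 = 1 :> R.
    by move=> iT; apply: sum_weight_sqr; exact: blk_full.
  have := deriv_bound_chain blk_gt0 w1 p.-1 (s *: x) v1; rewrite prednK// => b.
  have := deriv_boundZ C (deriv_bound_comp_scale s b).
  by rewrite !gtr0_norm//; exact: deriv_bound_le.
- have inf_ge : ((- (C * T%:R))%:E <= ereal_inf [set (hard sg T x)%:E | x in [set: 'rV[R]_d]])%E.
    apply/ereal_infP => _ [x _ <-]; rewrite lee_fin /hard /rescale -mulrN.
    by rewrite ler_pM2l// chain_ge.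
  have h0 : hard sg T 0 <= 0.
    by rewrite /hard /rescale scaler0 pmulr_rle0// chain0_le0.
  apply: (@le_trans _ _ (0%:E - (- (C * T%:R))%:E)%E).
    by apply: leeB; rewrite ?lee_fin.
  by rewrite -EFinB lee_fin sub0r opprK.
Qed.

Lemma hard_grad_gt sg x : (0 < T)%N -> act blk (weight blk sg) T (s *: x) < 2 ->
  C * s * (kappa / 4) < enorm (grad (hard sg T) x).
Proof.
move=> T0 A2; rewrite grad_rescale; last exact: chain_elementary.
rewrite enormZ gtr0_norm ?mulr_gt0// ltr_pM2l ?mulr_gt0//.
by apply: chain_grad_gt => // i iT; apply: sum_weight_sqr; exact: blk_full.
Qed.

Lemma jet_hard_trunc sg t x : (t <= T)%N ->
  (forall i, (t <= i < T)%N -> act blk (weight blk sg) i (s *: x) < 1) ->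
  jet (hard sg T) x = jet (hard sg t) x.
Proof.
move=> tT H; apply/funext => l; apply: eq_partial_near.
by apply: rescale_near; exact: chain_near.
Qed.

Lemma hard_flip i r sg t : (t < i)%N -> hard (flip blk i r sg) t = hard sg t.
Proof.
move=> ti; rewrite /hard; congr rescale; apply: chain_trunc => k kt.
by rewrite /weight ffunE; case: eqP kt => // -> it; rewrite leqNgt ti in it.
Qed.

End HardInstance.

Section Simulation.
Context {R : realType} (A : rand_algorithm R) {d : nat}.
Implicit Types (ff gg : nat -> 'rV[R]_d -> R) (xi : R).

(** The run of an algorithm whose j-th query is answered with the jet of ff j
instead of the jet of one function. *)
Fixpoint sim_history ff xi (i : nat) : i.-tuple (jet_space R d) :=
  if i is j.+1 then
    [tuple of rcons (sim_history ff xi j)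
       (jet (ff j) (query A d j (xi, sim_history ff xi j)))]
  else [tuple].

Definition sim_iterate ff i xi : 'rV[R]_d := query A d i (xi, sim_history ff xi i).

Lemma eq_sim_iterate ff gg i xi : (forall j, (j < i)%N -> ff j = gg j) ->
  sim_iterate ff i xi = sim_iterate gg i xi.
Proof.
move=> fg; congr (query _ _ _ (_, _)).
elim: i fg => //= i IH fg; rewrite IH ?fg// => j ji.
by apply: fg; rewrite ltnW.
Qed.

Lemma iterate_sim f ff i xi :
  (forall j, (j < i)%N -> jet f (sim_iterate ff j xi) = jet (ff j) (sim_iterate ff j xi)) ->
  iterate A f i xi = sim_iterate ff i xi.
Proof.
move=> fg; congr (query _ _ _ (_, _)).
elim: i fg => //= i IH fg; rewrite IH; last by move=> j ji; apply: fg; rewrite ltnW.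
by congr [tuple of rcons _ _]; exact: fg.
Qed.

End Simulation.

(** * Averaging over signs and seeds *)

Section Averaging.
Context {R : realType} (A : rand_algorithm R) {d : nat}.
Variables (blk : 'I_d -> nat) (T m : nat) (C s : R).
Hypothesis blk_gt0 : forall k, (0 < blk k)%N.
Hypothesis m0 : (0 < m)%N.
Hypothesis blk_m : forall i, (0 < i <= T)%N -> (m <= blk_size blk i)%N.
Hypotheses (C0 : 0 < C) (s0 : 0 < s).
Implicit Types (sg : {ffun 'I_d -> bool}) (xi : R).

(* The run in which query j is answered with the chain truncated to j+1 terms;
   its j-th iterate involves only the signs of blocks 1 to j. *)
Let iter_sg xi j sg := s *: sim_iterate A (fun t => hard blk C s sg t.+1) j xi.

(** The failure event of the union bound: query j depends only on the signs of
blocks 1 to j, so it can activate block l+1 > j only by chance. *)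
Definition guessed xi sg : bool := [exists j : 'I_T, exists l : 'I_T,
  (j <= l)%N && (1 <= act blk (weight blk sg) l.+1 (iter_sg xi j sg))].

Lemma card_guessed xi : #|[pred sg | guessed xi sg]|%:R
  <= T%:R ^+ 2 * expR (- (m%:R / 32)) * 2 ^+ d :> R.
Proof.
pose B (j l : 'I_T) := [pred sg | (j <= l)%N &&
  (1 <= act blk (weight blk sg) l.+1 (iter_sg xi j sg))].
have cardB j l : #|B j l|%:R <= expR (- (m%:R / 32)) * 2 ^+ d :> R.
  have [jl|lj] := leqP j l; last first.
    rewrite eq_card0; first by rewrite mulr_ge0 ?expR_ge0// exprn_ge0.
    by move=> sg; rewrite !inE leqNgt lj.
  rewrite (@eq_card _ _ [pred sg | 1 <= act blk (weight blk sg) l.+1 (iter_sg xi j sg)]);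
    last by move=> sg; rewrite !inE jl.
  have flip_inv sg r : iter_sg xi j (flip blk l.+1 r sg) = iter_sg xi j sg.
    congr (_ *: _); apply: eq_sim_iterate => t tj.
    by apply: hard_flip; rewrite ltnS (leq_trans tj).
  apply: le_trans (card_act_ge1 (ltn0Sn l) flip_inv) _.
  rewrite ler_wpM2r ?exprn_ge0// ler_expR lerN2 ler_wpM2r// ler_nat.
  by apply: blk_m; rewrite ltn_ord.
have -> : T%:R ^+ 2 * expR (- (m%:R / 32)) * 2 ^+ d =
    \sum_(j < T) \sum_(l < T) (expR (- (m%:R / 32)) * 2 ^+ d) :> R.
  by rewrite !sumr_const !card_ord -mulrnA -[RHS]mulr_natl natrM expr2 mulrA.
apply: le_trans (ler_sum _ (fun j _ => ler_sum _ (fun l _ => cardB j l))).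
under eq_bigr do rewrite -natr_sum.
rewrite -natr_sum ler_nat -sum1_card big_mkcond /=.
under [leqRHS]eq_bigr do under eq_bigr do rewrite -sum1_card big_mkcond /=.
under [leqRHS]eq_bigr do rewrite exchange_big /=.
rewrite exchange_big /=; apply: leq_sum => sg _.
rewrite inE; case: ifP => // /existsP[j /existsP[l jl]].
by rewrite (bigD1 j)//= (bigD1 l)//= /B inE jl.
Qed.

(** Without a guess the simulated run is the true run, and its points leave
block T locked. *)
Lemma not_guessed_large_grad xi sg j : ~~ guessed xi sg -> (j < T)%N ->
  C * s * (kappa / 4) <
  enorm (grad (hard blk C s sg T) (iterate A (hard blk C s sg T) j xi)).
Proof.
move=> /existsPn ng jT.
have blk_full i : (0 < i <= T)%N -> (0 < blk_size blk i)%N.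
  by move=> iT; exact: leq_trans (blk_m iT).
have lt1 t l : (t < T)%N -> (t <= l < T)%N -> act blk (weight blk sg) l.+1
    (iter_sg xi t sg) < 1.
  move=> tT /andP[tl lT]; rewrite ltNge; apply/negP => A1.
  by have /existsP[] := ng (Ordinal tT); exists (Ordinal lT); rewrite /= tl A1.
rewrite (iterate_sim (ff := fun t => hard blk C s sg t.+1)); last first.
  move=> t tj; apply: jet_hard_trunc; first by rewrite (leq_trans tj)// ltnW.
  case=> // i /andP[ti iT]; apply: lt1; first by rewrite (ltn_trans tj).
  by rewrite -ltnS ti ltnW.
apply: hard_grad_gt => //; first by rewrite (leq_trans _ jT).
have T0 : (0 < T)%N by rewrite (leq_trans _ jT).
have := @lt1 j T.-1 jT; rewrite (prednK T0) => /(_ _).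
by move=> H; apply: lt_trans (H _) _; [lia|rewrite ltr1n].
Qed.

Let P : probability _ R := uniform_prob (@ltr01 R).

Let E sg t := [set xi : R | forall j, (j < t)%N -> C * s * (kappa / 4) <
  enorm (grad (hard blk C s sg T) (iterate A (hard blk C s sg T) j xi))].

Lemma measurable_E sg t : measurable (E sg t).
Proof. exact: (measurable_large_grad _ (elementary_smooth (hard_elementary _ _ _ _ _))). Qed.

(** For every seed more than half of the sign patterns are not guessed;
integrate the number of successful patterns over the seed. *)
Lemma exists_resisting : T%:R ^+ 2 * expR (- (m%:R / 32)) < 2^-1 :> R ->
  exists sg, ((2^-1)%:E < P (E sg T))%E.
Proof.
set delta := _ * _ => delta2; apply/not_existsP => small.
have {}small sg : (P (E sg T) <= (2^-1)%:E)%E by rewrite leNgt; apply/negP/small.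
have le1 : (\int[P]_xi (\sum_sg (\1_(E sg T) xi)%:E) <= (2 ^+ d * 2^-1)%:E)%E.
  rewrite ge0_integral_sum//=.
  - apply: (@le_trans _ _ (\sum_(sg : {ffun 'I_d -> bool}) (2^-1)%:E)%E).
      apply: lee_sum => sg _.
      by rewrite (integral_indic P measurableT (measurable_E sg T)) setIT; exact: small.
    rewrite sumEFin lee_fin sumr_const card_ffun card_bool card_ord.
    by rewrite -[X in X <= _]mulr_natl natrX.
  - by move=> sg; apply/measurable_EFinP; apply: measurable_indic; exact: measurable_E.
have le2 : (((1 - delta) * 2 ^+ d)%:E <= \int[P]_xi (\sum_sg (\1_(E sg T) xi)%:E))%E.
  have <- : (\int[P]_xi (cst ((1 - delta) * 2 ^+ d)%:E xi) = ((1 - delta) * 2 ^+ d)%:E)%E.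
    by rewrite integral_cst// -[X in (_ * X)%E]/(P setT) probability_setT mule1.
  apply: ge0_le_integral => //.
  - by move=> xi _; rewrite lee_fin mulr_ge0 ?exprn_ge0//; lra.
  - apply: emeasurable_sum => sg; apply/measurable_EFinP; apply: measurable_indic.
    exact: measurable_E.
  move=> xi _ /=; rewrite sumEFin lee_fin.
  have cardF : 2 ^+ d = #|[pred sg | guessed xi sg]|%:R +
      #|[predC [pred sg | guessed xi sg]]|%:R :> R.
    by rewrite -natrD cardC card_ffun card_bool card_ord natrX.
  have cg := card_guessed xi; rewrite -/delta in cg.
  apply: (@le_trans _ _ #|[predC [pred sg | guessed xi sg]]|%:R); first by lra.
  rewrite -sum1_card natr_sum big_mkcond /=; apply: ler_sum => sg _.
  rewrite !inE; case: ifP => // ng; rewrite indicE mem_set// => j jT.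
  exact: not_guessed_large_grad.
have := le_trans le2 le1; rewrite lee_fin => le3.
have p2 : 0 < 2 ^+ d :> R by rewrite exprn_gt0.
have : (2^-1 - delta) * 2 ^+ d <= 0 by lra.
by rewrite pmulr_lle0// => H; lra.
Qed.

Lemma alg_complexity_ge sg : ((2^-1)%:E < P (E sg T))%E ->
  ((T.+1)%:R%:E <= alg_complexity A (C * s * (kappa / 4)) (hard blk C s sg T))%E.
Proof.
move=> P2; apply/ereal_infP => _ [t [t0 Pt] <-]; rewrite lee_fin ler_nat ltnNge.
apply/negP => tT; have : (P (E sg T) <= P (E sg t))%E.
  apply: le_measure; rewrite ?inE; try exact: measurable_E.
  by move=> xi H j jt; apply: H; exact: leq_trans tT.
by move=> /(lt_le_trans P2); rewrite ltNge Pt.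
Qed.

End Averaging.

(** * Constants and the lower bound *)

(** Distributing the coordinates cyclically over the blocks 1 to T uses all d
of them, with no leftover block to treat apart. *)
Lemma blk_size_modn (d T m i : nat) : (T * m <= d)%N -> (0 < i <= T)%N ->
  (m <= blk_size (fun k : 'I_d => (k %% T).+1) i)%N.
Proof.
move=> Tm /andP[i0 iT]; have T0 : (0 < T)%N by exact: leq_trans iT.
have lt_d (j : 'I_m) : (j * T + i.-1 < d)%N.
  apply: leq_trans Tm; rewrite -addnS prednK//.
  apply: (@leq_trans (j * T + T)); first by rewrite leq_add2l.
  by rewrite addnC -mulSn mulnC leq_mul2l ltn_ord orbT.
pose f (j : 'I_m) : 'I_d := Ordinal (lt_d j).
have injf : injective f.
  move=> j j' /(congr1 val) /= /eqP; rewrite eqn_add2r eqn_mul2r => /orP[/eqP T00|/eqP jj'].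
    by rewrite T00 in T0.
  exact: val_inj.
rewrite -[m in (m <= _)%N]card_ord -(card_codom injf) /blk_size.
apply/subset_leq_card/fintype.subsetP => _ /codomP[j ->]; rewrite inE /=.
by rewrite modnMDl modn_small ?prednK.
Qed.

Section Constants.
Context {R : realType}.

(** Lets terms linear in p be absorbed by c p log p + c, also for p = 1. *)
Lemma le_mul_ln (p : nat) : (0 < p)%N -> p%:R <= p%:R * ln p%:R + 1 :> R.
Proof.
move=> p0; have pR : 0 < p%:R :> R by rewrite ltr0n.
have := expR_ge1Dx (- ln p%:R : R); rewrite expRN lnK ?posrE// => H.
have : p%:R * (1 - ln p%:R) <= p%:R * p%:R^-1 :> R by rewrite ler_wpM2l// ltW.
rewrite divff ?gt_eqF//; lra.
Qed.

Lemma fact_le_exp n : (n`! <= n ^ n)%N.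
Proof.
elim: n => // n IH; rewrite factS expnS leq_mul2l/=.
by case: n IH => // n IH; rewrite (leq_trans IH)// leq_exp2r.
Qed.

Lemma chain_bound_le (p : nat) : (0 < p)%N ->
  chain_bound p.+1 / (kappa / 4) <= expR (2000 * p%:R * ln p%:R + 2000) :> R.
Proof.
move=> p0; have pR : 1 <= p%:R :> R by rewrite ler1n.
have lp0 : 0 <= ln p%:R :> R by rewrite ln_ge0.
have pe n : n%:R <= expR n%:R :> R.
  by apply: le_trans (expR_ge1Dx _); rewrite lerDr.
have b1 : 10 ^+ p.+1 <= expR (200 * p%:R) :> R.
  apply: (@le_trans _ _ (expR 100 ^+ p.+1)).
    by rewrite lerXn2r ?nnegrE ?expR_ge0//; apply: le_trans (pe 100%N); rewrite ler_nat.
  by rewrite -expRM_natl ler_expR -natr1; lra.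
have b2 : (3 * p.+1)`!%:R <= expR (6 * p%:R * (6 + ln p%:R)) :> R.
  apply: (@le_trans _ _ ((6 * p) ^ (6 * p))%:R).
    rewrite ler_nat (leq_trans (fact_le_exp _))//.
    apply: (@leq_trans ((6 * p) ^ (3 * p.+1))); first by rewrite leq_exp2r//; lia.
    by rewrite leq_pexp2l//; lia.
  rewrite natrX -[leRHS]/(expR _) -natrM expRM_natl lerXn2r ?nnegrE ?expR_ge0//.
  rewrite expRD lnK ?posrE ?(lt_le_trans ltr01)// natrM ler_wpM2r ?(le_trans ler01)//.
have b3 : chain_bound p.+1 <= 3 * (expR (200 * p%:R) * expR (6 * p%:R * (6 + ln p%:R))) :> R.
  have b12 := ler_pM (exprn_ge0 p.+1 (ler0n R 10)) (ler0n R _) b1 b2.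
  have : 1 <= 10 ^+ p.+1 * (3 * p.+1)`!%:R :> R.
    by rewrite -natrX -natrM ler1n muln_gt0 expn_gt0 fact_gt0.
  rewrite /chain_bound; lra.
have e3 : expR 3 != 0 :> R by rewrite gt_eqF ?expR_gt0.
have -> : chain_bound p.+1 / (kappa / 4) = 576 * expR 3 * chain_bound p.+1 :> R.
  by rewrite /kappa expRN; field.
set Q := expR _ * expR _ in b3.
have E0 : 0 <= expR 3 :> R := expR_ge0 _.
have EQ : 0 <= expR 3 * Q by rewrite mulr_ge0// mulr_ge0 ?expR_ge0.
apply: (@le_trans _ _ (expR 1728 * (expR 3 * Q))).
  apply: (@le_trans _ _ (1728 * (expR 3 * Q))); last by rewrite ler_wpM2r.
  have := ler_wpM2l E0 b3; lra.
rewrite /Q -!expRD ler_expR.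
have := le_mul_ln p0; have : 0 <= p%:R * ln p%:R :> R by rewrite mulr_ge0//; lra.
rewrite -!mulrA; lra.
Qed.

Lemma union_bound_lt (T : nat) :
  T%:R ^+ 2 * expR (- ((128 * T).+1%:R / 32)) < 2^-1 :> R.
Proof.
have -> : (128 * T).+1%:R = 128 * T%:R + 1 :> R by rewrite -addn1 natrD natrM.
have T0 : 0 <= T%:R :> R by [].
set y := (_ + 1) / 32; have y0 : 0 <= y by rewrite /y; lra.
have e : 1 + y ^+ 2 / 2 <= expR y := expR_ge1Dxn 1 y0.
have y2 : 16 * T%:R ^+ 2 <= y ^+ 2.
  have -> : 16 * T%:R ^+ 2 = (4 * T%:R) ^+ 2 :> R by ring.
  by rewrite lerXn2r ?nnegrE ?mulr_ge0// /y; lra.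
by rewrite expRN ltr_pdivrMr ?expR_gt0//; have := sqr_ge0 (T%:R : R); lra.
Qed.

Lemma kappa4_le1 : kappa / 4 <= 1 :> R.
Proof. have := @kappa_le1 R; lra. Qed.

End Constants.

Lemma class_complexity_ge (R : realType) (eps : R) (F : fun_class R) (r : \bar R) :
  (forall A : rand_algorithm R, exists d (f : 'rV[R]_d -> R),
     F d f /\ (r <= alg_complexity A eps f)%E) ->
  (r <= class_complexity eps (@A_rand R) F)%E.
Proof.
move=> H; apply/ereal_infP => _ [A _ <-]; have [d [f [Ff rf]]] := H A.
by apply: le_trans rf _; apply: ereal_sup_ubound; exists d, f.
Qed.

Lemma exists_hard_function (R : realType) (A : rand_algorithm R) (d T p : nat)
  (C s Delta L : R) :
  (0 < d)%N -> (0 < p)%N -> (T * (128 * T).+1 <= d)%N -> 0 < C -> 0 < s ->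
  C * T%:R <= Delta -> C * (s ^+ p.+1 * chain_bound p.+1) <= L ->
  exists2 f : 'rV[R]_d -> R, Fclass p Delta L f &
    ((T.+1)%:R%:E <= alg_complexity A (C * s * (kappa / 4)) f)%E.
Proof.
move=> d0 p0 Td C0 s0 CD CL.
pose blk (k : 'I_d) := (k %% T).+1.
have blk_gt0 k : (0 < blk k)%N by [].
have blk_m i : (0 < i <= T)%N -> ((128 * T).+1 <= blk_size blk i)%N.
  by move=> iT; exact: blk_size_modn.
have [sg sgP] := exists_resisting A blk_gt0 (ltn0Sn _) blk_m C0 s0 (union_bound_lt T).
exists (hard blk C s sg T); last exact: alg_complexity_ge sgP.
apply: hard_Fclass => // i iT; exact: leq_trans (blk_m i iT).
Qed.

Theorem theorem2 (R : realType) :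
  exists (c0 c1 c2 : R) (ell : nat -> R),
    [/\ 0 < c0, 0 < c1, 0 < c2 &
      forall p : nat, (0 < p)%N ->
        [/\ 0 < ell p,
            ell p <= expR (c1 * p%:R * ln p%:R + c1) &
            forall Delta L eps : R, 0 < Delta -> 0 < L -> 0 < eps ->
              let x := Delta * (L / ell p) `^ (p%:R^-1)
                       * eps `^ (- ((1 + p%:R) / p%:R)) in
              let d := `|Num.ceil (Num.max 1 (1 + c2 * qfun x) : R)%R|%N in
              ((c0 * x)%:E <=
                 class_complexity eps (@A_rand R) (Fclass p Delta L))%E /\
              ((c0 * x)%:E <=
                 class_complexity eps (@A_rand R)
                   (restrict_dim d (Fclass p Delta L)))%E]].
Proof.
have g0 : 0 < kappa / 4 :> R by rewrite divr_gt0// kappa_gt0.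
exists (kappa / 4), 2000, 258, (fun p => chain_bound p.+1 / (kappa / 4)).
split; [exact: g0|by rewrite ltr0n|by rewrite ltr0n|move=> p p0].
have cb0 : 0 < chain_bound p.+1 :> R.
  by rewrite ltr_wpDl// mulr_ge0// exprn_ge0.
have ell0 : 0 < chain_bound p.+1 / (kappa / 4) :> R by rewrite divr_gt0.
split=> //; first exact: chain_bound_le.
move=> Delta L eps D0 L0 e0 x d.
have pR : 0 < p%:R :> R by rewrite ltr0n.
set g := kappa / 4 in g0 ell0 x d *; set ell := chain_bound p.+1 / g in ell0 x d *.
(* s^p = L / (ell eps) and x = Delta s / eps: the scale of the argument fixes
   the ratio of the p-th derivative to the gradient. *)
pose s := (L / ell) `^ p%:R^-1 * eps `^ (- p%:R^-1).
have s0 : 0 < s by rewrite mulr_gt0// powR_gt0// divr_gt0.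
have sp : s ^+ p = L / (ell * eps).
  rewrite exprMn -!powR_mulrn ?powR_ge0// -!powRrM mulNr mulVf ?gt_eqF//.
  by rewrite (powRr1 (ltW (divr_gt0 L0 ell0))) (powR_inv1 (ltW e0)) (invfM ell eps) mulrA.
have xE : x = Delta * s / eps.
  rewrite /x /s mulrDl mul1r divff ?gt_eqF// opprD powRD; last by rewrite (gt_eqF e0) implybT.
  by rewrite (powR_inv1 (ltW e0)) !mulrA.
have x0 : 0 < x by rewrite xE divr_gt0// mulr_gt0.
pose T := Num.truncn (g * x).
have /andP[Tle Tlt] : T%:R <= g * x < T.+1%:R.
  by apply: truncn_itv; rewrite mulr_ge0// ltW.
have g1 : g <= 1 := kappa4_le1.
have d_ge : Num.max 1 (1 + 258 * qfun x) <= d%:R.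
  rewrite /d natr_absz ger0_norm; first exact: ceil_ge.
  by rewrite -(ler_int R) (le_trans _ (ceil_ge _))// le_max ler01.
have d0 : (0 < d)%N.
  rewrite -(ltr0n R); apply: lt_le_trans d_ge; by rewrite lt_max ltr01.
have Td : (T * (128 * T).+1 <= d)%N.
  have [->//|T0] := posnP T.
  rewrite -(ler_nat R) (le_trans _ d_ge)// le_max; apply/orP; right.
  have T1 : 1 <= T%:R :> R by rewrite ler1n.
  have Tx : T%:R <= x by rewrite (le_trans Tle)// ler_piMl// ltW.
  (* x >= T >= 1, hence log (2 x) >= 1/2 and 258 q(x) >= 129 T^2. *)
  have ln2 : 2^-1 <= ln (2 * x).
    have x2 : 0 < 2 * x by rewrite mulr_gt0.
    have := expR_ge1Dx (- ln (2 * x)); rewrite expRN lnK ?posrE// => H.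
    have : (2 * x)^-1 <= 2^-1 by rewrite lef_pV2 ?posrE//; lra.
    lra.
  have q2 : T%:R ^+ 2 * 2^-1 <= qfun x.
    by rewrite /qfun ler_pM ?exprn_ge0// lerXn2r ?nnegrE ?(ltW x0).
  have -> : (T * (128 * T).+1)%:R = T%:R * (128 * T%:R + 1) :> R.
    by rewrite natrM -addn1 natrD natrM.
  nra.
(* The gradient of the rescaled function is C s times that of the chain. *)
pose C := eps / (s * g).
have C0 : 0 < C by rewrite divr_gt0// mulr_gt0.
have CE : C * s * (kappa / 4) = eps.
  rewrite -/g /C; field; by rewrite (gt_eqF s0) (gt_eqF g0).
have CD : C * T%:R <= Delta.
  apply: le_trans (ler_wpM2l (ltW C0) Tle) _.
  rewrite xE /C le_eqVlt; apply/orP; left; apply/eqP; field.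
  by rewrite (gt_eqF s0) (gt_eqF g0) (gt_eqF e0).
have CL : C * (s ^+ p.+1 * chain_bound p.+1) <= L.
  have cbE : chain_bound p.+1 = ell * g by rewrite /ell divfK// (gt_eqF g0).
  rewrite exprS sp cbE /C le_eqVlt; apply/orP; left; apply/eqP; field.
  by rewrite (gt_eqF s0) (gt_eqF g0) (gt_eqF e0) (gt_eqF ell0).
have H A : exists2 f : 'rV[R]_d -> R, Fclass p Delta L f &
    ((g * x)%:E <= alg_complexity A eps f)%E.
  have [f Ff] := exists_hard_function A d0 p0 Td C0 s0 CD CL.
  rewrite CE => cf; exists f => //; apply: le_trans cf.
  by rewrite lee_fin ltW.
split; apply: class_complexity_ge => A; have [f Ff cf] := H A; exists d, f => //.
Qed.
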